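(* Let $n\ge3$, let $q$ be a power of an odd prime, and let $D_{2^{n+1}}=\langle a,b\mid a^{2^n}=1,\ b^2=1,\ b^{-1}ab=a^{-1}\rangle$. The semisimple group algebra $\mathbb{F}_qD_{2^{n+1}}$ decomposes into minimal left ideals generated by a complete set of primitive orthogonal idempotents, given by: (i) four central idempotents $e_1,e_2,e_3,e_4$; (ii) for each $2\le j\le n$, the $2\dfrac{\phi(2^j)}{\kappa\,o_{2^j}(q)}$ left idempotents $e_{2^j,k}\widehat{\langle b\rangle}$ and $e_{2^j,k}(1-\widehat{\langle b\rangle})$, where $\kappa=2$ for $r+1\le j\le n$ if $r$ is such that $-1\in\langle q\rangle\bmod 2^r$ but $-1\notin\langle q\rangle\bmod 2^{r+1}$, and $\kappa=1$ in all other cases.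
   Context: $\phi$ is Euler's totient; $o_m(q)$ is the multiplicative order of $q$ modulo $m$; $\langle q\rangle\bmod 2^j$ is the subgroup of $(\mathbb{Z}/2^j)^*$ generated by $q$. For a subgroup $X$, $\widehat X=\frac1{|X|}\sum_{x\in X}x$. Write $G=D_{2^{n+1}}$. Then $e_1=\widehat G$, $e_2=\widehat{\langle a\rangle}-\widehat G$, $e_3=\widehat{\langle a^2,b\rangle}-\widehat G$, $e_4=\widehat{\langle a^2,ab\rangle}-\widehat G$. For $2\le j\le n$, let $\xi_{2^j}$ be a primitive $2^j$-th root of unity in $\overline{\mathbb{F}}_q$, $\operatorname{tr}$ the trace from $\mathbb{F}_q(\xi_{2^j})$ to $\mathbb{F}_q$, $\gamma$ the character of $\langle a\rangle/\langle a^{2^j}\rangle$ sending the class of $a$ to $\xi_{2^j}$, $k$ an odd integer, and $C=C_q(\gamma^k)=\{\gamma^{kq^t}:t\ge0\}$. Put $\epsilon_C(\langle a\rangle,\langle a^{2^j}\rangle)=\frac1{2^j}\widehat{\langle a^{2^j}\rangle}\sum_{i=0}^{2^j-1}\operatorname{tr}(\xi_{2^j}^{ki})a^{-i}$. Then $e_{2^j,k}$ is the sum of the distinct $G$-conjugates of $\epsilon_C(\langle a\rangle,\langle a^{2^j}\rangle)$; it is a primitive central idempotent of $\mathbb{F}_qG$. Here $k$ runs over representatives of the $G$-orbits (under conjugation) of the cosets $C_q(\gamma^k)$, $k$ odd, so that the $e_{2^j,k}$ are pairwise distinct. *)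

(* Defs.v *)
From HB Require Import structures.
From mathcomp Require Import all_boot all_order all_algebra.
From mathcomp Require Import all_fingroup all_solvable all_field all_character.

Set Implicit Arguments.
Unset Strict Implicit.
Unset Printing Implicit Defensive.

Import GRing.Theory.
Local Open Scope ring_scope.

(* The default value 1 is used only when q is not invertible modulo m. *)
Definition unit_mod (m q : nat) : {unit 'Z_m} := insubd (1%g : {unit 'Z_m}) (q%:R : 'Z_m).

Definition order_mod (m q : nat) : nat := #[unit_mod m q]%g.

Definition gen_mod (m q : nat) : {set 'Z_m} := [set val u | u in <[unit_mod m q]>%g].

(* The condition r + 1 <= j is the bound on r : 'I_j.  The case r = 0, where
   -1 = 1 both modulo 2 ^ r and modulo 2 ^ r.+1, never occurs; it is excluded
   explicitly because 'Z_1 is not the zero ring. *)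
Definition kappa (q j : nat) : nat :=
  if [exists r : 'I_j, [&& (0 < r)%N, -1 \in gen_mod (2 ^ r) q
                         & -1 \notin gen_mod (2 ^ r.+1) q]]
  then 2%N else 1%N.

(* a and b generate G and satisfy the relations, and G has the presentation;
   hence < a, b | a ^ m = b ^ 2 = 1, b^-1 a b = a^-1 > is G with its
   distinguished generators (x ^ y is y^-1 * x * y). *)
Definition dihedral_presentation (gT : finGroupType) (G : {group gT})
    (m : nat) (a b : gT) : Prop :=
  [/\ G :=: <<[set a; b]>>%g,
      [/\ (a ^+ m = 1)%g, (b ^+ 2 = 1)%g & (a ^ b = a^-1)%g]
    & (G \isog Grp (x : y : (x ^+ m, y ^+ 2, x ^ y = x^-1)))%g].

Section Ideals.

Variables (F : fieldType) (N m : nat) (A : 'A[F]_(m, N)).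

Definition left_ideal (e : 'M[F]_N) : 'A[F]_N := (A * mxvec e)%MS.

Definition minimal_left_ideal (I : 'A[F]_N) : Prop :=
  [/\ (I <= A)%MS, left_mx_ideal A I, I != 0
    & forall J : 'A[F]_N,
        (J <= I)%MS -> left_mx_ideal A J -> J != 0 -> (I <= J)%MS].

Definition idempotent_in (e : 'M[F]_N) : Prop := (e \in A)%MS /\ e *m e = e.

Definition primitive_idempotent (e : 'M[F]_N) : Prop :=
  [/\ idempotent_in e, e != 0
    & forall f g : 'M[F]_N,
        idempotent_in f -> idempotent_in g ->
        f *m g = 0 -> g *m f = 0 -> e = f + g -> f = 0 \/ g = 0].

Definition complete_primitive_orthogonal (s : seq 'M[F]_N) : Prop :=
  [/\ forall e, e \in s -> primitive_idempotent e,
      forall i l : 'I_(size s), i != l -> s`_i *m s`_l = 0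
    & \sum_(e <- s) e = 1%:M].

(* I is kept abstract because mxdirect unfolds its argument, and left_ideal is
   itself defined by a sum. *)
Definition direct_sum_decomposition (k : nat) (I : 'I_k -> 'A[F]_N) : Prop :=
  mxdirect (\sum_(i < k) I i)%MS /\ (\sum_(i < k) I i :=: A)%MS.

Definition decomposes_into_minimal_left_ideals (s : seq 'M[F]_N) : Prop :=
  (forall e, e \in s -> minimal_left_ideal (left_ideal e)) /\
  direct_sum_decomposition (fun i : 'I_(size s) => left_ideal s`_i).

End Ideals.

Section Cosets.

Variables (F : finFieldType) (L : splittingFieldType F).
Variables (gT : finGroupType) (G : {group gT}) (a : gT) (j : nat) (xi : L).

Local Notation N := <[a ^+ (2 ^ j)]>%g.

(* The character gamma^k of <[a]> / N, where gamma maps the class of a to xi;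
   like MathComp class functions, it is 0 outside <[a]> / N. *)
Definition gamma_pow (k : int) : {ffun coset_of N -> L} :=
  [ffun x => \sum_(i < 2 ^ j | x == coset N (a ^+ i)%g) xi ^ (k * i%:Z)].

Definition conj_char (g : gT) (chi : {ffun coset_of N -> L}) :
    {ffun coset_of N -> L} :=
  [ffun x => chi (x ^ (coset N g)^-1)%g].

(* Membership in C_q(gamma^k), with q = #|F|. *)
Definition in_coset (k : int) (chi : {ffun coset_of N -> L}) : Prop :=
  exists t : nat, chi = gamma_pow (k * (#|F| ^ t)%N%:Z).

Definition coset_conjugate (k l : int) : Prop :=
  exists2 g, g \in G &
    forall chi, in_coset l chi <->
      exists2 psi, in_coset k psi & chi = conj_char g psi.

Definition orbit_representatives (s : seq int) : Prop :=
  [/\ uniq s, forall k, k \in s -> odd `|k|%N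
    & forall k : int, odd `|k|%N ->
        exists! l : int, l \in s /\ coset_conjugate k l].

End Cosets.

(* The trace from F(xi) to F, as an element of F: galTrace is the same
   element seen in L. *)
Definition tr_adjoin (F : finFieldType) (L : splittingFieldType F)
    (xi x : L) : F :=
  odflt 0 [pick c : F | c%:A == galTrace 1 <<1; xi>> x].

(* The group algebra F G is group_ring F G: the subalgebra of matrices spanned
   by the images of the elements of G under the regular representation. *)
Section GroupAlgebra.

Variables (F : finFieldType) (gT : finGroupType) (G : {group gT}).

Local Notation emb := (regular_repr F G).

Definition hat (X : {set gT}) : 'M[F]_#|G| := #|X|%:R^-1 *: gset_mx F G X.

Definition gconj (x : 'M[F]_#|G|) (g : gT) : 'M[F]_#|G| :=
  emb g^-1%g *m x *m emb g.

Variables a b : gT.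

Definition e1 := hat G.
Definition e2 := hat <[a]>%g - hat G.
Definition e3 := hat <<[set (a ^+ 2)%g; b]>>%g - hat G.
Definition e4 := hat <<[set (a ^+ 2)%g; (a * b)%g]>>%g - hat G.

Variable L : splittingFieldType F.

Definition epsilonC (j : nat) (xi : L) (k : int) : 'M[F]_#|G| :=
  ((2 ^ j)%N%:R)^-1 *:
    (hat <[a ^+ (2 ^ j)]>%g *m
     \sum_(i < 2 ^ j) tr_adjoin xi (xi ^ (k * i%:Z)) *: emb (a ^- i)%g).

(* The set of conjugates discards repetitions. *)
Definition ejk (j : nat) (xi : L) (k : int) : 'M[F]_#|G| :=
  \sum_(x in [set gconj (epsilonC j xi k) g | g in G]) x.

Definition level_idempotents (j : nat) (xi : L) (s : seq int) :
    seq 'M[F]_#|G| :=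
  flatten [seq [:: ejk j xi k *m hat <[b]>%g;
                   ejk j xi k *m (1%:M - hat <[b]>%g)] | k <- s].

Definition all_idempotents (n : nat) (xi : nat -> L) (s : nat -> seq int) :
    seq 'M[F]_#|G| :=
  [:: e1; e2; e3; e4] ++
  flatten [seq level_idempotents j (xi j) (s j) | j <- index_iota 2 n.+1].

End GroupAlgebra.

(* Main.v *)
(* An element p(a) = sum_i p_i a^i of F<a> is determined by the values of the
   polynomial p at the 2^n-th roots of unity x of L, and those values satisfy
   p(x^q) = p(x)^q; conjugation by b replaces p(x) by p(1/x).  The elements <a>^,
   <a^2>^ - <a>^ and e_{2^j,k} correspond to the indicator functions of the orbits
   of 1, -1 and xi_j^k under x |-> x^q and x |-> 1/x, and these orbits partition
   the 2^n-th roots of unity.  Writing f for <b>^ or 1 - <b>^, so that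
   b f = +f or -f, every idempotent of the list has the form u f with u such an
   indicator; in particular e1 = <a>^ <b>^, e2 = <a>^ (1 - <b>^) and
   e3, e4 = (<a^2>^ - <a>^) f.  Every element of FG u f is y u f with y in F<a>.
   If it is nonzero, a power of y u is the indicator of a nonempty
   Frobenius-stable part of the orbit; this part and its conjugate by b cover
   the orbit, so the left ideal generated by y u f contains u f.  Hence FG u f
   is minimal.  The number of orbits at level j is the index in (Z/2^j)^* of the
   subgroup generated by q and -1, which has order kappa times that of q. *)

Require Import Defs.
From HB Require Import structures.
From mathcomp Require Import all_boot all_order all_algebra.
From mathcomp Require Import all_fingroup all_solvable all_field all_character.

Set Implicit Arguments.
Unset Strict Implicit.
Unset Printing Implicit Defensive.

Import GRing.Theory.
Local Open Scope ring_scope.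

(** * Left ideals generated by orthogonal idempotents *)

Section LeftIdeals.

Variables (F : fieldType) (N m : nat) (A : 'A[F]_(m, N)).
Hypothesis A1 : (1%:M \in A)%MS.
Hypothesis AM : forall x y : 'M[F]_N, (x \in A -> y \in A -> x *m y \in A)%MS.

Lemma left_idealP (e x : 'M[F]_N) :
  reflect (exists2 y, (y \in A)%MS & x = y *m e) (x \in left_ideal A e)%MS.
Proof.
apply: (iffP idP) => [/mulsmxP[B BA [C Ce ->]] | [y yA ->]].
  (* Each right factor lies on the line spanned by [e], so its scalar can be moved into the left
     factor. *)
  have /= Cc i : exists c, C i == c *: e.
    have /sub_rVP[c Hc] := Ce i; exists c; apply/eqP.
    by apply: (can_inj mxvecK); rewrite linearZ /= Hc.
  exists (\sum_i xchoose (Cc i) *: B i).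
    by rewrite linear_sum summx_sub // => i _; rewrite linearZ /= scalemx_sub ?BA.
  rewrite mulmx_suml; apply: eq_bigr => i _.
  by rewrite {1}(eqP (xchooseP (Cc i))) -scalemxAr -scalemxAl.
by apply: mem_mulsmx.
Qed.

Lemma left_ideal_sub (e : 'M[F]_N) : (e \in A)%MS -> (left_ideal A e <= A)%MS.
Proof. by move=> eA; apply/memmx_subP=> x /left_idealP[y yA ->]; apply: AM. Qed.

Lemma left_ideal_gen (e : 'M[F]_N) : (e \in left_ideal A e)%MS.
Proof. by apply/left_idealP; exists 1%:M; rewrite ?mul1mx. Qed.

Lemma left_ideal_ideal (e : 'M[F]_N) : left_mx_ideal A (left_ideal A e).
Proof.
apply/mulsmx_subP=> x y xA /left_idealP[z zA ->].
by apply/left_idealP; exists (x *m z); rewrite ?mulmxA // AM.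
Qed.

Lemma left_ideal_subP (e : 'M[F]_N) (J : 'A[F]_N) :
  left_mx_ideal A J -> (e \in J)%MS -> (left_ideal A e <= J)%MS.
Proof.
move=> /mulsmx_subP idJ eJ; apply/memmx_subP=> x /left_idealP[y yA ->].
exact: idJ.
Qed.

(** A nonzero left ideal inside [A e] contains some nonzero [x e]; if [e] can be recovered from each
    of these, the ideal is all of [A e]. *)
Lemma left_ideal_minimal (e : 'M[F]_N) :
    (e \in A)%MS -> e != 0 ->
    (forall (x : 'M[F]_N) (J : 'A[F]_N), left_mx_ideal A J -> (x \in A)%MS ->
       x *m e != 0 -> (x *m e \in J)%MS -> (e \in J)%MS) ->
  minimal_left_ideal A (left_ideal A e).
Proof.
move=> eA e0 He; split.
- exact: left_ideal_sub.
- exact: left_ideal_ideal.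
- apply: contra_neq e0 => I0; have := left_ideal_gen e.
  by rewrite I0 => /memmx0.
move=> J sJI idJ nzJ; apply: left_ideal_subP => //.
have /rowV0Pn[v vJ v0] := nzJ.
have /left_idealP[y yA Dv] : (vec_mx v \in left_ideal A e)%MS.
  by rewrite vec_mxK; apply: submx_trans vJ sJI.
apply: (He y J) => //; last by rewrite -Dv vec_mxK.
by rewrite -Dv; apply: contra_neq v0 => v0; rewrite -[v]vec_mxK v0 linear0.
Qed.

(** If [e = f + g] with [f] nonzero, then [A f] is a nonzero left ideal inside [A e]. Minimality
    gives [e = x f], whence [g = e g = x f g = 0]. *)
Lemma minimal_primitive (e : 'M[F]_N) :
  idempotent_in A e -> minimal_left_ideal A (left_ideal A e) ->
  primitive_idempotent A e.
Proof.
move=> ide [_ _ I0 minI]; split=> //.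
  apply: contra_neq I0 => ->; apply/eqP; rewrite -submx0.
  by apply/memmx_subP=> x /left_idealP[y _ ->]; rewrite mulmx0 linear0 submx0.
move=> f g [fA ff] [gA gg] fg gf De; have [-> | f0] := eqVneq f 0; first by left.
right; have fe : f *m e = f by rewrite De mulmxDr ff fg addr0.
have sfe : (left_ideal A f <= left_ideal A e)%MS.
  apply: left_ideal_subP (left_ideal_ideal e) _.
  by apply/left_idealP; exists f.
have nzf : left_ideal A f != 0.
  apply: contra_neq f0 => I0'; have := left_ideal_gen f.
  by rewrite I0' => /memmx0.
have /memmx_subP/(_ e (left_ideal_gen e))/left_idealP[x _ Dx] :=
  minI _ sfe (left_ideal_ideal f) nzf.
have eg : e *m g = g by rewrite De mulmxDl fg gg add0r.
by rewrite -eg Dx -mulmxA fg mulmx0.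
Qed.

(** Right multiplication by [e i] fixes [A (e i)] and kills the other summands, so the sum is
    direct; it is all of [A] because [x] is the sum of the [x (e i)]. *)
Lemma idempotent_decomposition (k : nat) (e : 'I_k -> 'M[F]_N) :
    (forall i, idempotent_in A (e i)) ->
    (forall i l, i != l -> e i *m e l = 0) -> \sum_i e i = 1%:M ->
  direct_sum_decomposition A (fun i => left_ideal A (e i)).
Proof.
move=> ide orth sum1; split.
  apply/mxdirect_sumsP=> i _; apply/eqP; rewrite -submx0; apply/memmx_subP=> x.
  rewrite sub_capmx => /andP[/left_idealP[y yA Dx]].
  have xe : x = x *m e i by rewrite Dx -mulmxA (ide i).2.
  move/memmx_sumsP=> [B Bx Be]; rewrite xe Bx mulmx_suml big1 ?linear0 ?submx0 //.
  by move=> l li; have /left_idealP[z _ ->] := Be l; rewrite -mulmxA orth ?mulmx0.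
apply/eqmxP/andP; split.
  apply/sumsmx_subP => i _; apply: left_ideal_sub; exact: (ide i).1.
apply/memmx_subP=> x xA; rewrite -[x]mulmx1 -sum1 mulmx_sumr linear_sum.
rewrite summx_sub // => i _; apply: (submx_trans _ (sumsmx_sup i _ (submx_refl _))) => //.
by apply/left_idealP; exists x.
Qed.

(** The assumption [uniq s] turns orthogonality of distinct elements into orthogonality at distinct
    positions. *)
Lemma complete_orthogonal_decomposition (s : seq 'M[F]_N) :
    (forall e, e \in s -> idempotent_in A e) ->
    (forall e, e \in s -> minimal_left_ideal A (left_ideal A e)) ->
    uniq s -> {in s &, forall e f, e != f -> e *m f = 0} ->
    \sum_(e <- s) e = 1%:M ->
  complete_primitive_orthogonal A s /\ decomposes_into_minimal_left_ideals A s.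
Proof.
move=> ide mine us orth sum1.
have orth_nth (i l : 'I_(size s)) : i != l -> s`_i *m s`_l = 0.
  by move=> il; rewrite orth ?mem_nth ?nth_uniq.
split; split=> //.
- by move=> e es; apply: minimal_primitive; [apply: ide | apply: mine].
- apply: idempotent_decomposition => // [i|]; first by apply: ide; rewrite mem_nth.
  by rewrite -sum1 (big_nth 0) big_mkord.
Qed.

End LeftIdeals.

(** * Polynomials in a generator of the rotation subgroup *)

Section Dihedral.

Variables (gT : finGroupType) (G : {group gT}) (n : nat) (a b : gT).
Hypothesis n_gt0 : (0 < n)%N.

(** The shared presentation makes [G] and ['D_(2 ^ n.+1)] homomorphic images of each other, so they
    have the same order. Counting in [<a> <b>] then gives the orders of [a] and [b]. *)
Lemma dihedral_structure : dihedral_presentation G (2 ^ n) a b ->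
  [/\ #[a]%g = (2 ^ n)%N, #[b]%g = 2%N, b \notin <[a]>%g & (<[a]> * <[b]> = G)%g].
Proof.
case=> defG [am b2 ab] presG.
have presD : ('D_(2 ^ n.+1) \isog
    Grp (x : y : (x ^+ (2 ^ n), y ^+ 2, x ^ y = x^-1)))%g.
  exact: (@Grp_2dihedral n.+1).
have oG : #|G| = (2 ^ n.+1)%N.
  rewrite -(card_2dihedral (n_gt0 : (1 < n.+1)%N)); apply/eqP; rewrite eqn_leq.
  have GD : (G \homg [set: 'D_(2 ^ n.+1)])%g.
    by rewrite (presD _ G) -(presG _ G) homg_refl.
  have DG : ([set: 'D_(2 ^ n.+1)] \homg G)%g.
    by rewrite (presG _ _) -(presD _ _) homg_refl.
  by rewrite !leq_homg.
have {}defG : (<[a]> * <[b]> = G)%g.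
  rewrite -norm_joinEr ?norms_cycle ?ab ?groupV ?cycle_id //.
  by rewrite defG joing_idl joing_idr.
have notXb : b \notin <[a]>%g.
  apply: contraTN isT => Xb; have: (#|G| <= 2 ^ n)%N.
    by rewrite -defG mulGSid ?cycle_subG // dvdn_leq ?expn_gt0 // order_dvdn am.
  by rewrite oG leq_exp2l // ltnn.
have ob : #[b]%g = 2%N by apply: nt_prime_order (group1_contra notXb).
(* After doubling, the claim on [#[a]] reads [#[a] * #[b] = #|G|]. *)
split=> //; apply: double_inj; rewrite -muln2 -{1}ob -mul2n -expnS -oG -defG.
by rewrite TI_cardMg // setIC prime_TIg ?cycle_subG // -orderE ob.
Qed.

End Dihedral.

Section PolynomialsInElement.

Variables (F : fieldType) (gT : finGroupType) (G : {group gT}) (a : gT).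
Local Notation emb := (regular_repr F G).

(** Evaluation of [p] at [a] in the group algebra. *)
Definition gpoly (p : {poly F}) : 'M[F]_#|G| :=
  \sum_(i < size p) p`_i *: emb (a ^+ i)%g.

Lemma gpolyE k (p : {poly F}) : (size p <= k)%N ->
  gpoly p = \sum_(i < k) p`_i *: emb (a ^+ i)%g.
Proof.
move=> le_pk; rewrite /gpoly (big_ord_widen k (fun i => p`_i *: emb (a ^+ i)%g)) //.
rewrite big_mkcond; apply: eq_bigr => i _; case: ltnP => // /(nth_default 0) ->.
by rewrite scale0r.
Qed.

Fact gpoly_is_linear : linear gpoly.
Proof.
move=> c p q; pose k := maxn (size (c *: p + q)) (maxn (size p) (size q)).
rewrite !(@gpolyE k) ?leq_max ?leqnn ?orbT // scaler_sumr -big_split /=.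
by apply: eq_bigr => i _; rewrite coefD coefZ scalerDl scalerA.
Qed.
HB.instance Definition _ := GRing.isLinear.Build F {poly F} 'M[F]_#|G| _ gpoly
  gpoly_is_linear.

Lemma gpolyXn i : gpoly 'X^i = emb (a ^+ i)%g.
Proof.
rewrite (@gpolyE i.+1) ?size_polyXn // (bigD1 ord_max) //= coefXn eqxx scale1r.
rewrite big1 ?addr0 // => l; rewrite coefXn -val_eqE /= => /negPf->.
by rewrite scale0r.
Qed.

Lemma gpoly1 : gpoly 1 = 1%:M.
Proof. by rewrite -(expr0 'X) gpolyXn repr_mx1. Qed.

Hypothesis Ga : a \in G.

Lemma gpolyM p q : gpoly (p * q) = gpoly p *m gpoly q.
Proof.
have E r : gpoly r = \sum_(i < size r) r`_i *: gpoly 'X^i.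
  by apply: eq_bigr => i _; rewrite gpolyXn.
rewrite -{1}[p]coefK -{1}[q]coefK !poly_def mulr_suml linear_sum.
rewrite (E p) mulmx_suml; apply: eq_bigr => i _.
rewrite mulr_sumr linear_sum (E q) mulmx_sumr; apply: eq_bigr => l _.
rewrite -scalerAl -scalerAr -exprD !linearZ /= -scalemxAl linearZ /=.
by rewrite !gpolyXn -repr_mxM ?groupX // expgD.
Qed.

Lemma mem_gpoly p : (gpoly p \in group_ring F G)%MS.
Proof.
rewrite linear_sum summx_sub // => i _; rewrite linearZ scalemx_sub //.
by rewrite envelop_mx_id ?groupX.
Qed.

Lemma gpoly_conj g k p : g \in G -> (a ^ g = a ^+ k)%g ->
  emb g^-1%g *m gpoly p *m emb g = gpoly (p \Po 'X^k).
Proof.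
move=> Gg ag; rewrite comp_polyE [RHS]linear_sum (gpolyE (leqnn (size p))).
rewrite mulmx_sumr mulmx_suml; apply: eq_bigr => i _.
rewrite -scalemxAr -scalemxAl [RHS]linearZ /= -exprM gpolyXn.
rewrite -!repr_mxM ?groupM ?groupV ?groupX //; congr (_ *: emb _).
by rewrite -mulgA -conjgE conjXg ag expgM.
Qed.

Lemma gpoly_Xn_sub1 : gpoly ('X^#[a]%g - 1) = 0.
Proof. by rewrite linearB /= gpolyXn expg_order repr_mx1 gpoly1 subrr. Qed.

Lemma gpoly_modp p : gpoly (p %% ('X^#[a]%g - 1)) = gpoly p.
Proof.
by rewrite [p in RHS](divp_eq p ('X^#[a]%g - 1)) linearD /= gpolyM gpoly_Xn_sub1
  mulmx0 add0r.
Qed.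

Lemma gpoly_dvdp p : 'X^#[a]%g - 1 %| p -> gpoly p = 0.
Proof. by rewrite -gpoly_modp => /eqP->; rewrite linear0. Qed.

(** The elements [a ^ i] and [a ^ i * b] with [i < #[a]] are distinct, hence linearly independent in
    the group algebra; the coefficient of the product at [a ^ i] is that of the remainder of [p]. *)
Lemma gpoly_mul_eq0 b c p : b \in G -> b \notin <[a]>%g ->
  gpoly p *m (1%:M + c *: emb b) = 0 -> 'X^#[a]%g - 1 %| p.
Proof.
move=> Gb Xb; rewrite -gpoly_modp /dvdp; set r := p %% _ => r0.
have size_r : (size r <= #[a]%g)%N.
  by rewrite -ltnS -(size_XnsubC (1 : F) (order_gt0 a)) ltn_modp -size_poly_gt0
    size_XnsubC.
apply/eqP/polyP=> i; rewrite coef0.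
have [le_ai|lt_ia] := leqP #[a]%g i; first by rewrite nth_default ?(leq_trans size_r).
have Gai l : (a ^+ l)%g \in G by rewrite groupX.
(* The map [gring_proj] at [a ^ i] reads off the coefficient of [a ^ i]. *)
move/(congr1 (fun M => @gring_proj _ _ G (a ^+ i)%g M 0 0)): r0.
rewrite (gpolyE size_r) mulmx_suml !linear_sum /= linear0 summxE mxE.
rewrite (bigD1 (Ordinal lt_ia)) //= big1 => [|l /= ne_li].
  rewrite mulmxDr mulmx1 -scalemxAl -scalemxAr -repr_mxM // !linearD !linearZ /=.
  rewrite !gring_projE ?groupM // eqxx -{1}[(a ^+ i)%g]mulg1 (inj_eq (mulgI _)).
  have /negPf-> : (1 != b)%g by apply: contraNneq Xb => <-.
  by rewrite !mxE /= !mulr0 mulr1 !addr0.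
rewrite mulmxDr mulmx1 -scalemxAl -scalemxAr -repr_mxM // !linearD !linearZ /=.
rewrite !gring_projE ?groupM // -{2}(mulg1 (a ^+ i)%g).
have /negPf-> : (a ^+ i != a ^+ l)%g.
  by rewrite eq_expg_mod_order !modn_small // eq_sym.
have /negPf-> : (a ^+ i * 1 != a ^+ l * b)%g.
  apply: contraNneq Xb; rewrite mulg1 => Db.
  by rewrite -(groupMl _ (mem_cycle a l)) -Db mem_cycle.
by rewrite !mxE /= !mulr0 addr0.
Qed.

End PolynomialsInElement.

(** * Frobenius orbits of roots of unity *)

Lemma expr1_neq0 (R : nzRingType) (x : R) m : (0 < m)%N -> x ^+ m = 1 -> x != 0.
Proof.
move=> m_gt0 x1; apply: contra_eq_neq x1 => ->.
by rewrite expr0n gtn_eqF // eq_sym oner_eq0.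
Qed.

Section FrobeniusOrbits.

Variables (F : finFieldType) (L : fieldExtType F).
Local Notation q := #|F|.
Implicit Types (x y w : L) (p r : {poly F}).

Lemma pchar_nat_card : [pchar L].-nat q.
Proof.
have [p _ charFp] := finPcharP F.
have /and3P[pF _ _] := fin_ring_pchar_abelem charFp.
rewrite /pgroup cardsT in pF; apply: sub_in_pnat pF => l _ /eqP->.
by rewrite (fmorph_pchar (in_alg L)).
Qed.

(** The [q]-th power map is additive on [L] and fixes the coefficients, which lie in [F]. *)
Lemma horner_alg_frob p x : horner_alg (x ^+ q) p = horner_alg x p ^+ q.
Proof.
elim/poly_ind: p => [|p c IH].
  by rewrite !rmorph0 expr0n gtn_eqF // ltnW ?finNzRing_gt1.
rewrite !rmorphD !rmorphM /= !horner_algX !horner_algC IH.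
by rewrite exprDn_pchar ?pchar_nat_card // exprMn -in_algE -(rmorphXn (in_alg L)) /= expf_card.
Qed.

(** Typed on [finvect_type L], the finite type carried by [L], so that [fconnect] applies. *)
Definition frob (x : finvect_type L) : finvect_type L := x ^+ q.

Lemma frob_inj : injective frob.
Proof.
move=> x y /eqP; rewrite -subr_eq0 => xy; apply/eqP; rewrite -subr_eq0.
have: (x - y : L) ^+ q == 0.
  have q_odd := pchar_nat_card.
  move: xy; rewrite /frob => /eqP xy; apply/eqP; rewrite -[RHS]xy.
  by apply: (addIr (y ^+ q)); rewrite subrK -exprDn_pchar // subrK.
by rewrite expf_eq0 => /andP[].
Qed.

Lemma iter_frob t (x : finvect_type L) : iter t frob x = x ^+ (q ^ t).
Proof. by elim: t => // t IH; rewrite iterS IH /frob -exprM expnSr. Qed.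

(** The conjugates of [w] over [F]; on roots of unity, a [q]-cyclotomic coset written
    multiplicatively. *)
Definition frob_orbit w x := fconnect frob w x.

Lemma frob_orbitP w x : reflect (exists t, x = w ^+ (q ^ t)) (frob_orbit w x).
Proof.
apply: (iffP idP) => [wx | [t ->]]; last by rewrite -iter_frob; apply: fconnect_iter.
by exists (findex frob w x); rewrite -[LHS](iter_findex wx) iter_frob.
Qed.

Lemma frob_orbit_sym w x : frob_orbit w x = frob_orbit x w.
Proof. exact: fconnect_sym frob_inj w x. Qed.

Lemma frob_orbit_trans : transitive frob_orbit.
Proof. by move=> x w y; apply: connect_trans. Qed.

Lemma frob_orbitV w x : frob_orbit w^-1 x^-1 = frob_orbit w x.
Proof.
have imp u v : frob_orbit u v -> frob_orbit u^-1 v^-1.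
  by case/frob_orbitP=> t ->; apply/frob_orbitP; exists t; rewrite exprVn.
by apply/idP/idP => /imp; rewrite ?invrK.
Qed.

(** The orbit under Frobenius and inversion together. The two maps commute and inversion is an
    involution, so two cases exhaust it. *)
Definition frobV_orbit w x := frob_orbit w x || frob_orbit w x^-1.

Lemma frobV_orbit_refl w : frobV_orbit w w.
Proof. by rewrite /frobV_orbit /frob_orbit connect0. Qed.

Lemma frobV_orbitV w x : frobV_orbit w x^-1 = frobV_orbit w x.
Proof. by rewrite /frobV_orbit invrK orbC. Qed.

Lemma frobV_orbit_sym w x : frobV_orbit w x = frobV_orbit x w.
Proof.
by rewrite /frobV_orbit (frob_orbit_sym w x) -(frob_orbitV w) invrK (frob_orbit_sym w^-1).
Qed.

Lemma frobV_orbit_trans : transitive frobV_orbit.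
Proof.
have tr w x y : frobV_orbit w x -> frob_orbit x y -> frobV_orbit w y.
  case/orP=> wx xy; apply/orP; [left | right]; apply: frob_orbit_trans wx _ => //.
  by rewrite frob_orbitV.
move=> x w y wx /orP[/(tr _ _ _ wx)//|/(tr _ _ _ wx)].
by rewrite frobV_orbitV.
Qed.

(** By Fermat in the finite field [L], the exponent [#|L| - 1] turns a value into the indicator of
    its being nonzero. *)
Lemma expf_card_pred : exists2 m, (0 < m)%N & forall x, x ^+ m = (x != 0)%:R.
Proof.
exists #|finvect_type L|.-1 => [|x].
  by rewrite -ltnS prednK ?finNzRing_gt1 // ltnW ?finNzRing_gt1.
have gt1: (1 < #|finvect_type L|)%N := finNzRing_gt1 _.
have [->|x0] := eqVneq; first by rewrite expr0n gtn_eqF // -ltnS prednK // ltnW.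
apply: (mulfI x0); rewrite -exprS prednK ?(ltnW gt1) // mulr1.
exact: (expf_card (x : finvect_type L)).
Qed.

End FrobeniusOrbits.

(** * Evaluation of polynomials at the roots of unity *)

Section Evaluation.

Variables (F : fieldType) (L : fieldExtType F) (gT : finGroupType).
Variables (G : {group gT}) (a : gT) (z : L).
Hypotheses (Ga : a \in G) (prim_z : #[a]%g.-primitive_root z).
Implicit Type p : {poly F}.

(** Since [L] contains a primitive root of order [#[a]], the polynomial ['X^#[a] - 1] splits there
    into distinct linear factors. *)
Lemma dvdp_XsubX_roots p :
  ('X^#[a]%g - 1 %| p) <-> (forall x : L, x ^+ #[a]%g = 1 -> horner_alg x p = 0).
Proof.
split=> [/dvdpP[r ->] x x1|Hp].
  by rewrite rmorphM rmorphB /= rmorphXn /= horner_algX rmorph1 x1 subrr mulr0.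
rewrite -(dvdp_map (in_alg L)) rmorphB /= map_polyXn rmorph1.
rewrite -(factor_Xn_sub_1 prim_z) big_mkord.
rewrite -(big_map (fun i : 'I__ => z ^+ i) xpredT (fun x => 'X - x%:P)).
apply: uniq_roots_dvdp.
  apply/allP=> _ /mapP[i _ ->]; apply/rootP; apply: Hp.
  by rewrite exprAC (prim_expr_order prim_z) ?expr1n.
rewrite uniq_rootsE.
rewrite map_inj_uniq ?index_enum_uniq // => i l /eqP.
by rewrite (eq_prim_root_expr prim_z) !modn_small // => /eqP/val_inj.
Qed.

Lemma gpoly_eq0 p : (forall x : L, x ^+ #[a]%g = 1 -> horner_alg x p = 0) ->
  gpoly G a p = 0.
Proof. by move/dvdp_XsubX_roots; apply: gpoly_dvdp. Qed.

Lemma gpoly_eq p r :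
    (forall x : L, x ^+ #[a]%g = 1 -> horner_alg x p = horner_alg x r) ->
  gpoly G a p = gpoly G a r.
Proof.
move=> pr; apply/eqP; rewrite -subr_eq0 -linearB /=; apply/eqP/gpoly_eq0 => x x1.
by rewrite rmorphB /= pr ?subrr.
Qed.

End Evaluation.

(** * Idempotents attached to orbits *)

Section OrbitIdempotents.

Variables (F : finFieldType) (L : fieldExtType F) (gT : finGroupType).
Variables (G : {group gT}) (a b : gT) (z : L).
Hypotheses (Ga : a \in G) (Gb : b \in G) (prim_z : #[a]%g.-primitive_root z).
Hypotheses (ob : #[b]%g = 2%N) (ab : (a ^ b = a^-1)%g) (Xb : b \notin <[a]>%g).
Hypotheses (defG : (<[a]> * <[b]> = G)%g) (two_neq0 : 2%:R != 0 :> F).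

Local Notation emb := (regular_repr F G).
Local Notation R_G := (group_ring F G).
Local Notation gpoly := (gpoly G a).
Local Notation xp := (horner_alg (A:=L)).

(** For [c = 1] this is the hat of [<[b]>], and for [c = - 1] its complement. *)
Definition half_idem (c : F) : 'M[F]_#|G| := 2%:R^-1 *: (1%:M + c *: emb b).

Lemma emb_bb : emb b *m emb b = 1%:M.
Proof.
have bb : (b * b = 1)%g by have := expg_order b; rewrite ob.
by rewrite -repr_mxM // bb repr_mx1.
Qed.

Lemma mem_half_idem c : (half_idem c \in R_G)%MS.
Proof.
by rewrite /half_idem linearZ scalemx_sub // linearD addmx_sub ?envelop_mx1 //
  linearZ scalemx_sub ?envelop_mx_id.
Qed.

Lemma emb_half_idem c : c * c = 1 -> emb b *m half_idem c = c *: half_idem c.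
Proof.
move=> cc; rewrite /half_idem -scalemxAr mulmxDr mulmx1 -scalemxAr emb_bb.
rewrite [RHS]scalerA mulrC -[RHS]scalerA; congr (_ *: _).
by rewrite scalerDr scalerA cc scale1r addrC.
Qed.

Lemma half_idem_mul c d : c * c = 1 ->
  half_idem d *m half_idem c = (2%:R^-1 * (1 + d * c)) *: half_idem c.
Proof.
move=> cc; rewrite {1}/half_idem -scalemxAl mulmxDl mul1mx -scalemxAl.
by rewrite emb_half_idem // scalerA -{1}[half_idem c]scale1r -scalerDl scalerA.
Qed.

Lemma half_idem_idem c : c * c = 1 -> half_idem c *m half_idem c = half_idem c.
Proof. by move=> cc; rewrite half_idem_mul // cc mulVf ?scale1r. Qed.

Lemma half_idem_orth c : c * c = 1 -> half_idem (- c) *m half_idem c = 0.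
Proof. by move=> cc; rewrite half_idem_mul // mulNr cc subrr mulr0 scale0r. Qed.

Lemma half_idemD c : half_idem c + half_idem (- c) = 1%:M.
Proof.
rewrite -scalerDr scaleNr addrACA subrr addr0 -mulr2n -scaler_nat scalerA.
by rewrite mulVf ?scale1r.
Qed.

Lemma gpoly_half_idem_eq0 p c : gpoly p *m half_idem c = 0 ->
  forall x : L, x ^+ #[a]%g = 1 -> xp x p = 0.
Proof.
move/eqP; rewrite -scalemxAr scaler_eq0 invr_eq0 (negPf two_neq0) => /eqP pf0.
by apply/(dvdp_XsubX_roots prim_z); apply: gpoly_mul_eq0 pf0.
Qed.

(** The exponent [#[a].-1] stands for [-1], so that conjugation by [b] is a substitution in
    polynomials. *)
Lemma gpoly_conjb p : emb b^-1%g *m gpoly p *m emb b = gpoly (p \Po 'X^(#[a]%g.-1)).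
Proof. by apply: gpoly_conj => //; rewrite ab invg_expg. Qed.

Lemma horner_alg_comp_pred p (x : L) : x ^+ #[a]%g = 1 ->
  xp x (p \Po 'X^(#[a]%g.-1)) = xp x^-1 p.
Proof.
move=> x1; have -> : x^-1 = x ^+ #[a]%g.-1.
  have x0 := expr1_neq0 (order_gt0 a) x1.
  by apply: (mulfI x0); rewrite divff // -exprS prednK.
elim/poly_ind: p => [|p c IH]; first by rewrite comp_poly0 !rmorph0.
rewrite comp_polyD comp_polyM comp_polyX comp_polyC !rmorphD !rmorphM /= IH.
by rewrite !horner_algC rmorphXn /= !horner_algX.
Qed.

Lemma expr_invr1 (x : L) m : x ^+ m = 1 -> x^-1 ^+ m = 1.
Proof. by move=> x1; rewrite exprVn x1 invr1. Qed.

Lemma group_ring_gpoly (x : 'M[F]_#|G|) : (x \in R_G)%MS ->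
  exists p1 p2, x = gpoly p1 + gpoly p2 *m emb b.
Proof.
case/envelop_mxP=> c ->.
apply: (big_ind (fun y => exists p1 p2, y = gpoly p1 + gpoly p2 *m emb b)).
- by exists 0, 0; rewrite !linear0 mul0mx addr0.
- move=> _ _ [p1 [p2 ->]] [r1 [r2 ->]]; exists (p1 + r1), (p2 + r2).
  by rewrite !linearD mulmxDl addrACA.
move=> g; rewrite -{1}defG => /mulsgP[_ h /cycleP[i ->] bh ->].
move: bh; rewrite (cycle2g ob) !inE => /orP[] /eqP->.
  exists (c (a ^+ i * 1)%g *: 'X^i), 0.
  by rewrite linearZ /= gpolyXn linear0 mul0mx addr0 mulg1.
exists 0, (c (a ^+ i * b)%g *: 'X^i).
by rewrite linearZ /= gpolyXn linear0 add0r -scalemxAl -repr_mxM ?groupX.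
Qed.

(** A predicate and not a construction: the idempotents of the list come with their own formulas and
    are compared with the indicator of the orbit through their values. *)
Definition orbit_idem (w : L) (u : 'M[F]_#|G|) : Prop :=
  exists2 p, u = gpoly p &
    forall x : L, x ^+ #[a]%g = 1 -> xp x p = (frobV_orbit w x)%:R.

Lemma orbit_idem_idem w u : orbit_idem w u -> u *m u = u.
Proof.
case=> p -> Hp; rewrite -gpolyM //; apply: (gpoly_eq Ga prim_z) => x x1.
by rewrite rmorphM /= Hp // -natrM mulnb andbb.
Qed.

Lemma orbit_idem_orth w1 w2 u1 u2 : orbit_idem w1 u1 -> orbit_idem w2 u2 ->
  ~~ frobV_orbit w1 w2 -> u1 *m u2 = 0.
Proof.
move=> [p1 -> Hp1] [p2 -> Hp2] w12; rewrite -gpolyM //.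
apply: (gpoly_eq0 Ga prim_z) => x x1; rewrite rmorphM /= Hp1 // Hp2 // -natrM mulnb.
case: andP => // -[w1x w2x]; case/negP: w12.
by apply: frobV_orbit_trans w1x _; rewrite frobV_orbit_sym.
Qed.

(** The orbit is stable under inversion, so conjugation by [b] fixes [u]. *)
Lemma orbit_idem_comm_half w u c : orbit_idem w u ->
  u *m half_idem c = half_idem c *m u.
Proof.
case=> p -> Hp; have pb : gpoly p *m emb b = emb b *m gpoly p.
  suff pb : emb b^-1%g *m gpoly p *m emb b = gpoly p.
    by rewrite -{2}pb !mulmxA -repr_mxM ?groupV // mulgV repr_mx1 mul1mx.
  rewrite gpoly_conjb; apply: (gpoly_eq Ga prim_z) => x x1.
  by rewrite horner_alg_comp_pred // !Hp ?frobV_orbitV // expr_invr1.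
by rewrite -scalemxAr -scalemxAl mulmxDl mulmxDr mulmx1 mul1mx -scalemxAr -scalemxAl pb.
Qed.

Lemma orbit_idem_half_neq0 w u c : w ^+ #[a]%g = 1 -> orbit_idem w u ->
  u *m half_idem c != 0.
Proof.
move=> w1 [p -> Hp]; apply/eqP => /gpoly_half_idem_eq0/(_ _ w1)/eqP.
by rewrite Hp // frobV_orbit_refl oner_eq0.
Qed.

Lemma orbit_idem_mem w u : orbit_idem w u -> (u \in R_G)%MS.
Proof. by case=> p -> _; apply: mem_gpoly. Qed.

Lemma orbit_half_idempotent w u c : orbit_idem w u -> c * c = 1 ->
  idempotent_in R_G (u *m half_idem c).
Proof.
move=> uw cc; split; first by rewrite envelop_mxM ?mem_half_idem ?(orbit_idem_mem uw).
rewrite {2}(orbit_idem_comm_half c uw) mulmxA -(mulmxA u) half_idem_idem //.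
by rewrite -mulmxA -(orbit_idem_comm_half c uw) mulmxA (orbit_idem_idem uw).
Qed.

(* Raising an element of F<a> to a suitable power gives the indicator of its
   set of nonvanishing, which is stable under the Frobenius map; if the set is
   nonempty and contained in the orbit of w, then it and its image under
   inversion cover that orbit. *)
Lemma orbit_half_minimal w u c : w ^+ #[a]%g = 1 -> orbit_idem w u -> c * c = 1 ->
  minimal_left_ideal R_G (left_ideal R_G (u *m half_idem c)).
Proof.
move=> w1 uw cc; have [ufR _] := orbit_half_idempotent uw cc.
apply: left_ideal_minimal ufR (orbit_idem_half_neq0 c w1 uw) _.
- exact: envelop_mx1.
- by move=> x y; apply: envelop_mxM.
move=> _ J /mulsmx_subP idJ /group_ring_gpoly[p1 [p2 ->]].
set f := half_idem c; case: (uw) => p Dp Hp.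
(* Here [b] passes through [u f] to act on [f] as the scalar [c], so only a multiplier from [F<a>]
   remains. *)
have -> : (gpoly p1 + gpoly p2 *m emb b) *m (u *m f) = gpoly ((p1 + c *: p2) * p) *m f.
  have -> : gpoly ((p1 + c *: p2) * p) = (gpoly p1 + c *: gpoly p2) *m u.
    by rewrite gpolyM // -Dp linearD linearZ.
  rewrite -(mulmxA _ u) [in LHS]mulmxDl [in RHS]mulmxDl -(mulmxA _ (emb b)).
  congr (_ + _); rewrite /f (orbit_idem_comm_half c uw) (mulmxA (emb b)).
  by rewrite emb_half_idem // -!scalemxAl -scalemxAr.
set y := (_ + _) * p => yf0 yfJ.
have [m m_gt0 Hm] := expf_card_pred L.
pose s := y ^+ m; pose sb := s \Po 'X^(#[a]%g.-1).
have sfJ : (gpoly s *m f \in J)%MS.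
  by rewrite /s -(prednK m_gt0) exprSr gpolyM // -mulmxA idJ ?mem_gpoly.
(* Left multiplication by [b^-1] turns [s] into its conjugate [sb], once [f] is rewritten as [c]
   times [b f]. *)
have sbfJ : (gpoly sb *m f \in J)%MS.
  have -> : gpoly sb *m f = c *: (emb b^-1%g *m (gpoly s *m f)).
    have fE : f = c *: (emb b *m f) by rewrite emb_half_idem // scalerA cc scale1r.
    rewrite [in RHS]fE -(scalemxAr c (gpoly s)) -(scalemxAr c (emb _)) scalerA cc.
    by rewrite scale1r !mulmxA gpoly_conjb.
  by rewrite linearZ scalemx_sub // idJ ?envelop_mx_id ?groupV.
have sE x : xp x s = (xp x y != 0)%:R by rewrite rmorphXn /= Hm.
have sbE x : x ^+ #[a]%g = 1 -> xp x sb = (xp x^-1 y != 0)%:R.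
  by move=> x1; rewrite horner_alg_comp_pred.
have y_orb x : x ^+ #[a]%g = 1 -> xp x y != 0 -> frobV_orbit w x.
  move=> x1; rewrite rmorphM /= Hp //; case: frobV_orbit => //.
  by rewrite mulr0 eqxx.
have y_frob x v : frob_orbit x v -> xp x y != 0 -> xp v y != 0.
  case/frob_orbitP=> t ->; elim: t => [|t IH] //.
  by move/IH; rewrite expnSr exprM horner_alg_frob; apply: expf_neq0.
have [x0 x01 yx0] : exists2 x0 : L, x0 ^+ #[a]%g = 1 & xp x0 y != 0.
  have [i yi | y0] := pickP (fun i : 'I_#[a]%g => xp (z ^+ i) y != 0).
    by exists (z ^+ i); rewrite // exprAC (prim_expr_order prim_z) expr1n.
  case/eqP: yf0; rewrite -(mul0mx _ f); congr (_ *m f).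
  apply: (gpoly_eq0 Ga prim_z) => x /(prim_rootP prim_z)[i ->].
  by apply/eqP/negbFE/y0.
(* Inclusion and exclusion: the indicator of a union of two sets with indicators [s] and [sb] is
   [s + sb - sb * s]. *)
have -> : u *m f = gpoly s *m f + gpoly sb *m f - gpoly sb *m (gpoly s *m f).
  rewrite mulmxA -gpolyM // -mulmxDl -mulmxBl -linearD -linearB /= Dp; congr (_ *m f).
  apply: (gpoly_eq Ga prim_z) => x x1.
  rewrite Hp // rmorphB rmorphD rmorphM /= sE sbE //.
  have -> : frobV_orbit w x = (xp x y != 0) || (xp x^-1 y != 0).
    apply/idP/orP => [wx | [/y_orb->//|]]; last first.
      by move/y_orb; rewrite frobV_orbitV; apply; apply: expr_invr1.
    have: frobV_orbit x0 x.
      by apply: frobV_orbit_trans wx; rewrite frobV_orbit_sym y_orb.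
    by case/orP=> /y_frob/(_ yx0); [left | right].
  by case: (_ != 0); case: (_ != 0);
    rewrite ?mulr1 ?mul1r ?mulr0 ?mul0r ?subr0 ?addr0 ?add0r ?addrK.
rewrite linearB linearD addmx_sub ?addmx_sub // eqmx_opp idJ //.
exact: mem_gpoly.
Qed.

End OrbitIdempotents.

(** * The four central idempotents *)

Section CycleHat.

Variables (F : finFieldType) (L : fieldExtType F) (gT : finGroupType).
Variables (G : {group gT}) (a : gT) (z : L).
Hypotheses (Ga : a \in G) (prim_z : #[a]%g.-primitive_root z).

Lemma sum_cycle (V : nmodType) (x : gT) (f : gT -> V) :
  \sum_(y in <[x]>%g) f y = \sum_(i < #[x]%g) f (x ^+ i)%g.
Proof.
have -> : <[x]>%g = [set (x ^+ i)%g | i : 'I_#[x]%g].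
  apply/setP=> y; apply/idP/imsetP => [/cyclePmin[i lt_ix ->] | [i _ ->]].
    by exists (Ordinal lt_ix).
  exact: mem_cycle.
rewrite big_imset /= => [|i l _ _ /eqP]; first by apply: eq_bigl => i; rewrite inE.
by rewrite eq_expg_mod_order !modn_small // => /eqP/val_inj.
Qed.

Definition cycle_hat_poly (d : nat) : {poly F} :=
  #[(a ^+ d)%g]%g%:R^-1 *: \sum_(i < #[(a ^+ d)%g]%g) 'X^(d * i).

Lemma hat_cycle d : hat F G <[(a ^+ d)%g]>%g = gpoly G a (cycle_hat_poly d).
Proof.
rewrite /hat /gset_mx sum_cycle linearZ /=; congr (_ *: _).
by rewrite [RHS]linear_sum; apply: eq_bigr => i _; rewrite /= gpolyXn expgM.
Qed.

(** The value is an average of powers of [x ^ d], a geometric sum that vanishes unless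
    [x ^ d = 1]. *)
Lemma horner_cycle_hat d (x : L) : x ^+ #[a]%g = 1 ->
  horner_alg x (cycle_hat_poly d) = (x ^+ d == 1)%:R.
Proof.
move=> x1; set k := #[(a ^+ d)%g]%g.
(* The order [k] divides [#[a]], which is nonzero in [L] because [L] has a primitive root of that
   order. *)
have k_neq0 : k%:R != 0 :> L.
  rewrite (prim_root_dvd_eq0 prim_z) //.
  by rewrite order_dvdn expgAC expg_order expg1n.
rewrite linearZ rmorph_sum /=.
under eq_bigr do rewrite rmorphXn /= horner_algX exprM.
have [-> | xd] := eqVneq.
  under eq_bigr do rewrite expr1n.
  by rewrite sumr_const card_ord -in_algE fmorphV rmorph_nat mulVf.
have := subrX1 (x ^+ d) k; rewrite -exprM.
have /dvdnP[l ->] : (#[a]%g %| d * k)%N by rewrite order_dvdn expgM expg_order.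
rewrite mulnC exprM x1 expr1n subrr => /esym/eqP; rewrite mulf_eq0 subr_eq0.
by rewrite (negPf xd) /= => /eqP->; rewrite mulr0.
Qed.

End CycleHat.

(** Trivial intersection makes the factorization of each element of [K * H] unique, so the sum over
    [K * H] is the product of the two sums. *)
Lemma hat_mulg (F : finFieldType) (gT : finGroupType) (G K H : {group gT}) :
    K \subset G -> H \subset G -> K :&: H = 1%g ->
  hat F G (K * H)%g = hat F G K *m hat F G H.
Proof.
move=> sKG sHG tiKH; rewrite /hat TI_cardMg // -scalemxAl -scalemxAr scalerA.
rewrite natrM invfM; congr (_ *: _); rewrite /gset_mx.
rewrite /mulg /= /set_mulg curry_imset2X big_imset /=; last first.
  move=> [k1 h1] [k2 h2] /setXP[/= Kk1 Hh1] /setXP[/= Kk2 Hh2] E.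
  have : (k2^-1 * k1)%g \in K :&: H.
    rewrite inE groupM ?groupV //=.
    have -> : (k2^-1 * k1 = h2 * h1^-1)%g.
      by apply: (mulgI k2); apply: (mulIg h1); rewrite mulKVg -!mulgA mulVg mulg1.
    by rewrite groupM ?groupV.
  rewrite tiKH => /set1P k12; have {}k12 : k1 = k2.
    by rewrite -[k1](mulKVg k2) k12 mulg1.
  by move: E; rewrite k12 => /mulgI->.
rewrite mulmx_suml; under [RHS]eq_bigr do rewrite mulmx_sumr.
rewrite pair_big /=; apply: eq_big => [[k h]|[k h] /setXP[/= Kk Hh]].
  by rewrite in_setX.
by apply: (repr_mxM (regular_repr F G)); [apply: (subsetP sKG) | apply: (subsetP sHG)].
Qed.

Section CentralIdempotents.

Variables (F : finFieldType) (L : fieldExtType F) (gT : finGroupType).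
Variables (G : {group gT}) (a b : gT) (z : L).
Hypotheses (Ga : a \in G) (Gb : b \in G) (prim_z : #[a]%g.-primitive_root z).
Hypotheses (ob : #[b]%g = 2%N) (ab : (a ^ b = a^-1)%g) (Xb : b \notin <[a]>%g).
Hypotheses (defG : (<[a]> * <[b]> = G)%g) (two_neq0 : 2%:R != 0 :> F).

Local Notation emb := (regular_repr F G).
Local Notation half := (half_idem G b).

Lemma hat_involution g : #[g]%g = 2%N -> hat F G <[g]>%g = half_idem G g 1.
Proof.
move=> og; rewrite /hat /gset_mx sum_cycle -orderE og big_ord_recl big_ord1 /=.
by rewrite /half_idem scale1r expg0 repr_mx1.
Qed.

Lemma one_sub_hat_involution : 1%:M - hat F G <[b]>%g = half (- 1).
Proof. by rewrite hat_involution // -(half_idemD G b two_neq0 1) addrAC subrr add0r. Qed.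

Lemma tiX_involution d g : #[g]%g = 2%N -> g \notin <[a]>%g ->
  <[(a ^+ d)%g]>%g :&: <[g]>%g = 1%g.
Proof.
move=> og Xg; rewrite setIC prime_TIg -?orderE ?og // cycle_subG.
by apply: contra Xg; apply: (subsetP (cycleX a d)).
Qed.

(** As [g] inverts [a], it normalizes [<[a ^+ d]>], and the generated group is a product with
    trivial intersection. Stated for any such [g] because both [b] and [a * b] occur. *)
Lemma hat_gen d g : #[g]%g = 2%N -> g \in G -> g \notin <[a]>%g -> (a ^ g = a^-1)%g ->
  hat F G <<[set (a ^+ d)%g; g]>>%g = hat F G <[(a ^+ d)%g]>%g *m half_idem G g 1.
Proof.
move=> og Gg Xg ag.
have -> : <<[set (a ^+ d)%g; g]>>%g = (<[(a ^+ d)%g]> <*> <[g]>)%g.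
  by rewrite joing_idl joing_idr.
rewrite norm_joinEr; last first.
  by rewrite norms_cycle conjXg ag expgVn groupV cycle_id.
by rewrite hat_mulg ?cycle_subG ?groupX ?(hat_involution og) ?tiX_involution.
Qed.

Definition cycle_idem : 'M[F]_#|G| := hat F G <[a]>%g.
(** The idempotent of [F<a>] attached to the character sending [a] to [- 1]. *)
Definition alt_idem : 'M[F]_#|G| := hat F G <[(a ^+ 2)%g]>%g - hat F G <[a]>%g.

Lemma cycle_idemE : cycle_idem = gpoly G a (cycle_hat_poly F a 1).
Proof. by rewrite -hat_cycle. Qed.

Lemma alt_idemE : alt_idem = gpoly G a (cycle_hat_poly F a 2 - cycle_hat_poly F a 1).
Proof. by rewrite linearB /= -!hat_cycle. Qed.

Lemma two_neq0L : 2%:R != 0 :> L.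
Proof. by rewrite -(rmorph_nat (in_alg L)) fmorph_eq0. Qed.

Lemma horner_alt_idem (x : L) : x ^+ #[a]%g = 1 ->
  horner_alg x (cycle_hat_poly F a 2 - cycle_hat_poly F a 1) = (x == - 1)%:R.
Proof.
move=> x1; rewrite rmorphB /= !(horner_cycle_hat prim_z) // expr1 sqrf_eq1.
have [->|_] := eqVneq x 1; last by rewrite subr0.
by rewrite subrr -subr_eq0 opprK (negPf two_neq0L).
Qed.

Lemma frobV_orbit1 (x : L) : frobV_orbit 1 x = (x == 1).
Proof.
apply/idP/eqP => [|->]; last exact: frobV_orbit_refl.
by case/orP=> /frob_orbitP[t]; rewrite expr1n // => /(congr1 GRing.inv); rewrite invrK invr1.
Qed.

Lemma odd_card_field : odd #|F|.
Proof.
apply: contraNT two_neq0 => evF; have q2 : 2%N \in \pi(#|F|).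
  by rewrite mem_primes dvdn2 evF /= ltnW ?finNzRing_gt1.
by rewrite (pcharf0 (pnatPpi (pchar_nat_card F^o) q2)).
Qed.

Lemma frobV_orbitN1 (x : L) : frobV_orbit (- 1) x = (x == - 1).
Proof.
have E t : (- 1 : L) ^+ (#|F| ^ t) = - 1 by rewrite -signr_odd oddX odd_card_field orbT.
apply/idP/eqP => [|->]; last exact: frobV_orbit_refl.
by case/orP=> /frob_orbitP[t]; rewrite E // => /(congr1 GRing.inv); rewrite invrK invrN1.
Qed.

Lemma cycle_idem_orbit : orbit_idem a (1 : L) cycle_idem.
Proof.
exists (cycle_hat_poly F a 1); first exact: cycle_idemE.
by move=> x x1; rewrite (horner_cycle_hat prim_z) // expr1 frobV_orbit1.
Qed.

Lemma alt_idem_orbit : orbit_idem a (- 1 : L) alt_idem.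
Proof.
exists (cycle_hat_poly F a 2 - cycle_hat_poly F a 1); first exact: alt_idemE.
by move=> x x1; rewrite horner_alt_idem // frobV_orbitN1.
Qed.

Lemma e1E : e1 F G = cycle_idem *m half 1.
Proof.
rewrite /e1; have -> : hat F G G = hat F G (<[a]> * <[b]>)%g by rewrite defG.
rewrite hat_mulg ?cycle_subG //; last by rewrite -[a]expg1 tiX_involution.
by rewrite (hat_involution ob).
Qed.

Lemma e2E : e2 F G a = cycle_idem *m half (- 1).
Proof.
rewrite /e2 -/(e1 F G) e1E -/cycle_idem -one_sub_hat_involution mulmxBr mulmx1.
by rewrite (hat_involution ob).
Qed.

Lemma e3E : e3 F G a b = alt_idem *m half 1.
Proof. by rewrite /e3 -/(e1 F G) e1E hat_gen // -mulmxBl. Qed.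

Lemma emb_cycle_idem : cycle_idem *m emb a = cycle_idem.
Proof.
rewrite cycle_idemE -(gpolyXn F G a 1) -gpolyM //.
apply: (gpoly_eq Ga prim_z) => x x1.
rewrite rmorphM /= horner_algX (horner_cycle_hat prim_z) // expr1.
by case: eqP => [->|]; rewrite ?mulr1 ?mul0r.
Qed.

Lemma emb_alt_idem : alt_idem *m emb a = - alt_idem.
Proof.
rewrite alt_idemE -(gpolyXn F G a 1) -gpolyM // -[RHS](linearN (gpoly (F:=F) G a)).
apply: (gpoly_eq Ga prim_z) => x x1.
rewrite rmorphM rmorphN /= horner_algX horner_alt_idem //.
by case: eqP => [->|]; rewrite ?mul1r ?mul0r ?oppr0.
Qed.

(** Also [a * b] is an involution inverting [a]. Write the hat of [<[a ^+ 2]>] as [u + v] with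
    [u a = u] and [v a = - v]; then [(u + v) (1 + a b) - u (1 + b) = v (1 - b)]. *)
Lemma e4E : e4 F G a b = alt_idem *m half (- 1).
Proof.
have aab : (a ^ (a * b) = a^-1)%g by rewrite conjgM {1}[(a ^ a)%g]conjgE mulKg ab.
have abab : (a * b * (a * b) = 1)%g.
  by rewrite {1}(conjgC a b) ab -mulgA mulKg; have := expg_order b; rewrite ob.
have Xab : (a * b)%g \notin <[a]>%g by rewrite groupMl ?cycle_id.
have oab : #[(a * b)%g]%g = 2%N.
  by apply: (nt_prime_order (isT : prime 2) abab); apply: contraNneq Xab => ->; rewrite group1.
rewrite /e4 -/(e1 F G) e1E (hat_gen 2 oab (groupM Ga Gb) Xab aab).
have -> : hat F G <[(a ^+ 2)%g]>%g = cycle_idem + alt_idem by rewrite addrC subrK.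
move: emb_cycle_idem emb_alt_idem; move: cycle_idem alt_idem => u v ua va.
rewrite /half_idem repr_mxM // -!scalemxAr !scale1r scaleN1r -scalerBr; congr (_ *: _).
rewrite !mulmxDr !mulmxDl !mulmx1 !mulmxA ua va.
by rewrite mulNmx mulmxN (addrACA u) [_ + (v - _)]addrC addrK.
Qed.

End CentralIdempotents.

(** * The idempotents of level j *)

Section TraceIndicator.

Variables (F : finFieldType) (L : splittingFieldType F).
Implicit Types (xi w x : L).

(** The extension [F(xi) / F] is Galois, so the trace lies in [F] and the search in [tr_adjoin]
    succeeds. *)
Lemma tr_adjoinE xi x : x \in <<1; xi>>%VS ->
  (tr_adjoin xi x)%:A = galTrace 1 <<1; xi>> x.
Proof.
move=> xE; rewrite /tr_adjoin; case: pickP => [c /eqP // | no_c].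
have gal : galois 1 <<1; xi>> by apply: finField_galois; apply: sub1v.
have /vlineP[c Dc] := mem_galTrace gal xE.
by have := no_c c; rewrite Dc eqxx.
Qed.

(** The Galois group is cyclic, generated by the Frobenius automorphism. *)
Lemma galois_frob_orbit xi w x : w \in <<1; xi>>%VS ->
  reflect (exists2 s, s \in 'Gal(<<1; xi>> / 1)%g & s w = x) (frob_orbit w x).
Proof.
move=> wE; have [alpha /eqP gal_alpha Dalpha] :=
  finField_galois_generator (sub1v <<1; xi>>).
rewrite dimv1 expn1 in Dalpha.
have alphaX t : (alpha ^+ t)%g w = w ^+ (#|F| ^ t).
  elim: t => [|t IH]; first by rewrite expg0 gal_id.
  by rewrite expgSr galM // IH Dalpha ?rpredX // -exprM expnSr.
rewrite gal_alpha; apply: (iffP (frob_orbitP w x)) => [[t ->] | [_ /cycleP[t ->] <-]].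
  by exists (alpha ^+ t)%g; rewrite ?mem_cycle.
by exists t.
Qed.

(* Summing over i first, each automorphism s contributes a geometric sum with
   ratio s w / x, which vanishes unless s w = x. *)
Lemma sum_galTrace xi w x M l :
    w \in <<1; xi>>%VS -> xi = w ^+ l -> w ^+ M = 1 -> x ^+ M = 1 ->
  \sum_(i < M) galTrace 1 <<1; xi>> (w ^+ i) * x^-1 ^+ i
    = M%:R * (frob_orbit w x)%:R.
Proof.
move=> wE Dxi w1 x1; have [->|M_gt0] := posnP M; first by rewrite big_ord0 mul0r.
have x0 := expr1_neq0 M_gt0 x1.
under eq_bigr do rewrite mulr_suml.
rewrite exchange_big /=.
have E (s : gal_of <<1; xi>>) : \sum_(i < M) s (w ^+ i) * x^-1 ^+ i = M%:R * (s w == x)%:R :> L.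
  under eq_bigr do rewrite rmorphXn -exprMn /=.
  have [->|swx] := eqVneq (s w) x.
    by rewrite divff //; under eq_bigr do rewrite expr1n; rewrite sumr_const card_ord mulr1.
  have := subrX1 (s w / x) M; rewrite exprMn exprVn x1 -rmorphXn w1 rmorph1.
  rewrite divr1 subrr => /esym/eqP; rewrite mulf_eq0 subr_eq0.
  have /negPf-> : s w / x != 1 by apply: contraNneq swx => /divr1_eq->.
  by move=> /eqP->; rewrite mulr0.
under eq_bigr do rewrite E.
rewrite -mulr_sumr; congr (_ * _).
case: (galois_frob_orbit x wE) => [[s0 s0G s0w] | no_s]; last first.
  rewrite big1 // => s sG; case: eqP => // sw; case: no_s; by exists s.
rewrite (bigD1 s0) //= s0w eqxx big1 ?addr0 // => s /andP[sG ne_s].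
case: eqP => // sw; case/negP: ne_s.
(* Since [xi] is a power of [w], an automorphism of [F(xi)] is determined by its value at [w], so
   only [s0] contributes. *)
have sxi (t : gal_of <<1; xi>>) : t xi = t w ^+ l by rewrite -rmorphXn -Dxi.
by rewrite (gal_adjoin_eq sG s0G) !sxi sw s0w.
Qed.

End TraceIndicator.

Section PrimitiveRootPowers.

Variables (L : fieldType) (M : nat) (xi : L).
Hypothesis prim_xi : M.-primitive_root xi.

Lemma exprz_modz (k : int) : xi ^ k = xi ^+ `|(k %% M)%Z|%N.
Proof.
have M_gt0 := prim_order_gt0 prim_xi.
have xi_unit : xi \is a GRing.unit.
  by rewrite unitfE (expr1_neq0 M_gt0 (prim_expr_order prim_xi)).
have Mk : M%:Z != 0 by rewrite -[_ == _]/(M == 0%N) -lt0n.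
rewrite {1}(divz_eq k M) exprzDr // (mulrC (k %/ M)%Z) -exprz_exp -exprnP.
rewrite (prim_expr_order prim_xi).
by rewrite exp1rz mul1r -{1}(gez0_abs (modz_ge0 k Mk)) -exprnP.
Qed.

Lemma prim_root_exprz (k : int) :
  coprime `|k|%N M -> M.-primitive_root (xi ^ k).
Proof.
move=> co_kM; rewrite exprz_modz prim_root_exp_coprime //.
have M_gt0 := prim_order_gt0 prim_xi.
have Mk : M%:Z != 0 by rewrite -[_ == _]/(M == 0%N) -lt0n.
have := gcdz_modl k M; rewrite /gcdz => -[E].
by rewrite /coprime E.
Qed.

End PrimitiveRootPowers.

Section LevelIdempotents.

Variables (F : finFieldType) (L : splittingFieldType F) (gT : finGroupType).
Variables (G : {group gT}) (a b : gT) (z : L).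
Hypotheses (Ga : a \in G) (Gb : b \in G) (prim_z : #[a]%g.-primitive_root z).
Hypotheses (ob : #[b]%g = 2%N) (ab : (a ^ b = a^-1)%g) (Xb : b \notin <[a]>%g).
Hypotheses (defG : (<[a]> * <[b]> = G)%g) (two_neq0 : 2%:R != 0 :> F).
Variables (j : nat) (xi : L) (k : int).
Hypotheses (prim_xi : (2 ^ j).-primitive_root xi) (odd_k : odd `|k|%N).

Local Notation M := (2 ^ j)%N.
Local Notation N := #[a]%g.
Local Notation xp := (horner_alg (A:=L)).

Lemma prim_root_odd_exprz : M.-primitive_root (xi ^ k).
Proof. by apply: (prim_root_exprz prim_xi); rewrite coprimeXr ?coprimen2. Qed.

(** The factor [a ^- i] is encoded as ['X^(N.-1) ^+ i]. *)
Definition eps_poly : {poly F} :=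
  M%:R^-1 *: (cycle_hat_poly F a M *
    \sum_(i < M) tr_adjoin xi (xi ^ (k * i%:Z)) *: 'X^(N.-1) ^+ i).

Lemma epsilonCE : epsilonC G a j xi k = gpoly G a eps_poly.
Proof.
rewrite /epsilonC linearZ /= gpolyM // -hat_cycle; congr (_ *: (_ *m _)).
rewrite linear_sum; apply: eq_bigr => i _; rewrite linearZ /=; congr (_ *: _).
by rewrite -exprM gpolyXn expgM -invg_expg expgVn.
Qed.

(** The hat factor restricts to [x ^+ M = 1]; there the remaining sum is [M] times the indicator of
    the Frobenius orbit, by the trace computation. *)
Lemma horner_eps (x : L) : x ^+ N = 1 -> xp x eps_poly = (frob_orbit (xi ^ k) x)%:R.
Proof.
move=> x1; set w := xi ^ k; have prim_w : M.-primitive_root w := prim_root_odd_exprz.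
have x0 := expr1_neq0 (order_gt0 a) x1.
have xV : x ^+ N.-1 = x^-1.
  by apply: (mulfI x0); rewrite divff // -exprS prednK.
rewrite linearZ rmorphM /= (horner_cycle_hat prim_z) //.
have [xM | xM] := eqVneq (x ^+ M) 1; last first.
  rewrite mul0r; case: frob_orbitP => [[t Dx]|]; last by rewrite mulr0.
  by case/eqP: xM; rewrite Dx exprAC (prim_expr_order prim_w) expr1n.
have wE : w \in <<1; xi>>%VS.
  by rewrite /w (exprz_modz prim_xi) rpredX // memv_adjoin.
have [l Dxi] : exists l, xi = w ^+ l.
  have /(prim_rootP prim_w)[l ->] := prim_expr_order prim_xi.
  by exists l.
rewrite mul1r rmorph_sum /=.
have := sum_galTrace wE Dxi (prim_expr_order prim_w) xM.
rewrite (eq_bigr (fun i : 'I_M => xp x (tr_adjoin xi (xi ^ (k * i%:Z)) *: 'X^(N.-1) ^+ i))).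
  move=> ->; rewrite mulrA -in_algE fmorphV rmorph_nat mulVf ?mul1r //.
  exact: prim_root_natf_neq0 prim_xi.
move=> i _; rewrite linearZ /= !rmorphXn /= horner_algX xV -exprz_exp -exprnP.
by rewrite tr_adjoinE // rpredX.
Qed.

(** Powers of [a] centralize the element, so only conjugation by [b] can give a second conjugate. *)
Lemma gconj_epsilonC_set :
  [set gconj (epsilonC G a j xi k) g | g in G] =
  [set epsilonC G a j xi k; gpoly G a (eps_poly \Po 'X^(N.-1))].
Proof.
have aJ i : gconj (epsilonC G a j xi k) (a ^+ i)%g = epsilonC G a j xi k.
  rewrite epsilonCE /gconj (@gpoly_conj _ _ _ _ _ _ 1) ?comp_polyXr ?groupX //.
  by rewrite conjgE commuteX // mulKg.
have bJ : gconj (epsilonC G a j xi k) b = gpoly G a (eps_poly \Po 'X^(N.-1)).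
  by rewrite epsilonCE /gconj gpoly_conjb.
have gconjM g h x : g \in G -> h \in G ->
    gconj x (g * h)%g = gconj (gconj x g) h :> 'M[F]_#|G|.
  by move=> Gg Gh; rewrite /gconj invMg !repr_mxM ?groupV // !mulmxA.
apply/setP=> y; rewrite !inE; apply/imsetP/orP => [[g]|[]/eqP->].
- rewrite -{1}defG => /mulsgP[_ h /cycleP[i ->] bh ->] ->.
  have Gh : h \in G by apply: subsetP bh; rewrite cycle_subG.
  rewrite gconjM ?groupX // aJ; move: bh; rewrite (cycle2g ob) !inE.
  by case/orP=> /eqP->; [left; rewrite -(expg0 a) aJ | right; rewrite bJ].
- by exists 1%g; rewrite ?group1 // -(expg0 a) aJ.
by exists b; rewrite ?bJ.
Qed.

(** Either both conjugates agree and the Frobenius orbit of [w] is stable under inversion, or they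
    differ and the orbits of [w] and [w^-1] are disjoint, so that the sum is the indicator of their
    union. *)
Lemma ejk_orbit : orbit_idem a (xi ^ k) (ejk G a j xi k).
Proof.
set w := xi ^ k; rewrite /ejk gconj_epsilonC_set epsilonCE.
have epsV x : x ^+ N = 1 -> xp x (eps_poly \Po 'X^(N.-1)) = (frob_orbit w x^-1)%:R.
  by move=> x1; rewrite horner_alg_comp_pred // horner_eps // expr_invr1.
have gpoly_inj p r : gpoly G a p = gpoly G a r -> forall x, x ^+ N = 1 -> xp x p = xp x r.
  move=> E x x1; apply/eqP; rewrite -subr_eq0 -rmorphB; apply/eqP.
  apply: (gpoly_half_idem_eq0 (G := G) (b := b) Ga Gb prim_z Xb two_neq0 (c := 1)) => //.
  by rewrite linearB /= E subrr mul0mx.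
case: (eqVneq (gpoly G a eps_poly) (gpoly G a (eps_poly \Po 'X^(N.-1)))) => E.
  exists eps_poly; first by rewrite -E setUid big_set1.
  move=> x x1; rewrite horner_eps // /frobV_orbit.
  have := epsV x x1; rewrite -(gpoly_inj _ _ E) // horner_eps //.
  by case: (frob_orbit w x) => [_ | ->].
exists (eps_poly + (eps_poly \Po 'X^(N.-1))).
  by rewrite linearD big_setU1 ?big_set1 ?in_set1.
move=> x x1; rewrite rmorphD /= epsV // horner_eps // /frobV_orbit.
case wx: (frob_orbit w x); last by rewrite add0r.
case wxV: (frob_orbit w x^-1); last by rewrite addr0.
(* A common point of the two orbits makes them equal, and then the two conjugates coincide. *)
have wwV : frob_orbit w w^-1.
  by apply: frob_orbit_trans wxV _; rewrite frob_orbit_sym frob_orbitV.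
case/eqP: E; apply: (gpoly_eq Ga prim_z) => y y1; rewrite epsV // horner_eps //.
congr (_%:R); congr nat_of_bool; apply/idP/idP => wy.
  by apply: frob_orbit_trans wwV _; rewrite frob_orbitV.
by apply: frob_orbit_trans wwV _; rewrite -frob_orbitV invrK.
Qed.

End LevelIdempotents.

(** * Conjugacy of cosets and the number of orbits *)

Section CharacterCosets.

Variables (F : finFieldType) (L : splittingFieldType F) (gT : finGroupType).
Variables (G : {group gT}) (a b : gT) (n j : nat) (xi : L).
Hypotheses (oa : #[a]%g = (2 ^ n)%N) (ab : (a ^ b = a^-1)%g).
Hypotheses (Ga : a \in G) (Gb : b \in G) (ob : #[b]%g = 2%N).
Hypotheses (defG : (<[a]> * <[b]> = G)%g) (le_jn : (j <= n)%N).
Hypothesis prim_xi : (2 ^ j).-primitive_root xi.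

Local Notation M := (2 ^ j)%N.
Local Notation K := <[(a ^+ M)%g]>%g.
Local Notation c := (coset K a).

Lemma norm_cycleX : G \subset 'N(K)%g.
Proof.
rewrite -defG mul_subG ?(sub_abelian_norm (cycle_abelian a)) ?cycleX //.
by rewrite norms_cycle conjXg ab expgVn groupV cycle_id.
Qed.

Let Na : a \in 'N(K)%g. Proof. exact: subsetP norm_cycleX a Ga. Qed.
Let Nb : b \in 'N(K)%g. Proof. exact: subsetP norm_cycleX b Gb. Qed.

Lemma order_coset_cycle : #[c]%g = M.
Proof.
rewrite orderE -quotient_cycle // card_quotient ?cycle_subG //.
rewrite -divgS ?cycleX // -!orderE (orderXexp _ oa) oa -expnB ?leq_subr //.
by rewrite subKn.
Qed.

Lemma coset_cycleX i : coset K (a ^+ i)%g = (c ^+ i)%g.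
Proof. exact: morphX. Qed.

(** The character is indexed by its value [w] at the class of [a] instead of an exponent of [xi], so
    that cosets of characters become Frobenius orbits. *)
Definition char_of (w : L) : {ffun coset_of K -> L} :=
  [ffun x => \sum_(i < M | x == coset K (a ^+ i)%g) w ^+ i].

Lemma gamma_powE k : gamma_pow a j xi k = char_of (xi ^ k).
Proof.
by apply/ffunP=> x; rewrite !ffunE; apply: eq_bigr => i _; rewrite -exprz_exp -exprnP.
Qed.

Lemma char_of_cycle w i : w ^+ M = 1 -> char_of w (c ^+ i)%g = w ^+ i.
Proof.
move=> w1; have M_gt0 : (0 < M)%N by rewrite expn_gt0.
rewrite ffunE (bigD1 (Ordinal (ltn_pmod i M_gt0))) /=; last first.
  by rewrite coset_cycleX eq_expg_mod_order order_coset_cycle modn_mod.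
rewrite big1 ?addr0 => [|l /andP[/eqP]].
  by rewrite {2}(divn_eq i M) exprD mulnC exprM w1 expr1n mul1r.
move/eqP; rewrite coset_cycleX eq_expg_mod_order order_coset_cycle => /eqP il.
by rewrite -val_eqE /= il modn_small ?eqxx.
Qed.

Lemma char_of_notin w x : x \notin <[c]>%g -> char_of w x = 0.
Proof.
move=> Xx; rewrite ffunE big1 // => i /eqP Dx.
by case/negP: Xx; rewrite Dx coset_cycleX mem_cycle.
Qed.

Lemma char_of_inj w1 w2 : w1 ^+ M = 1 -> w2 ^+ M = 1 -> char_of w1 = char_of w2 -> w1 = w2.
Proof.
move=> w11 w21 /ffunP/(_ c%g); rewrite -[c]expg1.
by rewrite !char_of_cycle ?expr1.
Qed.

Lemma conj_char1 w : conj_char 1%g (char_of w) = char_of w.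
Proof. by apply/ffunP=> x; rewrite ffunE morph1 invg1 conjg1. Qed.

Lemma conj_charM g h (chi : {ffun coset_of K -> L}) : g \in G -> h \in G ->
  conj_char (g * h)%g chi = conj_char h (conj_char g chi).
Proof.
move=> Gg Gh; apply/ffunP=> x; rewrite !ffunE morphM ?(subsetP norm_cycleX) //.
by rewrite invMg conjgM.
Qed.

Lemma conj_char_cycle i w : conj_char (a ^+ i)%g (char_of w) = char_of w.
Proof.
apply/ffunP=> x; rewrite ffunE coset_cycleX; have [/cycleP[l ->]|Xx] := boolP (x \in <[c]>%g).
  by rewrite conjgE (commuteV (commuteX2 l i (commute_refl c))) mulKg.
have ci : (c ^+ i)^-1%g \in <[c]>%g by rewrite groupV mem_cycle.
by rewrite !char_of_notin // memJ_norm // (subsetP (normG _)).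
Qed.

Lemma conj_charb w : w ^+ M = 1 -> conj_char b (char_of w) = char_of w^-1.
Proof.
move=> w1; apply/ffunP=> x; rewrite ffunE.
have cb : (c ^ (coset K b)^-1 = c^-1)%g.
  by apply: (canLR (conjgK _)); rewrite conjVg -morphJ // ab morphV // invgK.
have [/cycleP[l ->]|Xx] := boolP (x \in <[c]>%g).
  rewrite conjXg cb expgVn.
  have M1 : w^-1 ^+ M = 1 by rewrite exprVn w1 invr1.
  have -> : (c ^- l = c ^+ (l * M.-1))%g.
    have cV := invg_expg c; rewrite order_coset_cycle in cV.
    by rewrite mulnC expgM -cV expgVn.
  rewrite !char_of_cycle // mulnC exprM; congr (_ ^+ _).
  apply: (mulfI (expr1_neq0 (prim_order_gt0 prim_xi) w1)).
  by rewrite divff ?(expr1_neq0 (prim_order_gt0 prim_xi) w1) // -exprS prednK // expn_gt0.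
have nb : (coset K b)^-1%g \in 'N(<[c]>)%g.
  by rewrite -cycle_subG norms_cycle cb groupV cycle_id.
by rewrite !char_of_notin // memJ_norm.
Qed.

Lemma in_cosetP k chi :
  in_coset xi k chi <-> exists2 w, frob_orbit (xi ^ k) w & chi = char_of w.
Proof.
split=> [[t ->]|[_ /frob_orbitP[t ->] ->]].
  exists ((xi ^ k) ^+ (#|F| ^ t)%N); first by apply/frob_orbitP; exists t.
  by rewrite gamma_powE -exprz_exp -exprnP.
by exists t; rewrite gamma_powE -exprz_exp -exprnP.
Qed.

Lemma frob_orbit_expr1 (w v : L) m : frob_orbit w v -> w ^+ m = 1 -> v ^+ m = 1.
Proof. by case/frob_orbitP=> t -> wm; rewrite exprAC wm expr1n. Qed.

(** Rotations act trivially on the characters of [<[a]> / K], and [b] inverts them; conjugacy of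
    cosets is therefore inversion up to Frobenius. *)
Lemma coset_conjugateP k l :
  coset_conjugate G a j xi k l <-> frobV_orbit (xi ^ k) (xi ^ l).
Proof.
have xi1 i : (xi ^ i) ^+ M = 1.
  by rewrite (exprz_modz prim_xi) exprAC (prim_expr_order prim_xi) expr1n.
split=> [[g Gg Hg]|].
  have /Hg[psi /in_cosetP[w kw ->]] : in_coset xi l (char_of (xi ^ l)).
    by apply/in_cosetP; exists (xi ^ l) => //; apply: connect0.
  have w1 := frob_orbit_expr1 kw (xi1 k).
  move: Gg; rewrite -{1}defG => /mulsgP[_ h /cycleP[i ->] bh ->].
  have Gh : h \in G by apply: subsetP bh; rewrite cycle_subG.
  rewrite conj_charM ?groupX // conj_char_cycle.
  move: bh; rewrite (cycle2g ob) !inE => /orP[]/eqP->.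
    by rewrite conj_char1 => /(char_of_inj (xi1 l) w1) ->; apply/orP; left.
  rewrite conj_charb // => /char_of_inj->; rewrite ?xi1 ?exprVn ?w1 ?invr1 //.
  by apply/orP; right; rewrite invrK.
case/orP=> kl.
  exists 1%g => // chi; split=> [/in_cosetP[w lw ->] | [_ /in_cosetP[w kw ->] ->]].
    exists (char_of w); last by rewrite conj_char1.
    by apply/in_cosetP; exists w => //; apply: frob_orbit_trans kl lw.
  rewrite conj_char1; apply/in_cosetP; exists w => //.
  by apply: frob_orbit_trans kw; rewrite frob_orbit_sym.
exists b => // chi; split=> [/in_cosetP[w lw ->] | [_ /in_cosetP[w kw ->] ->]].
  have w1 := frob_orbit_expr1 lw (xi1 l).
  exists (char_of w^-1); last by rewrite conj_charb ?invrK // exprVn w1 invr1.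
  apply/in_cosetP; exists w^-1 => //; apply: frob_orbit_trans kl _.
  by rewrite frob_orbitV.
rewrite (conj_charb (frob_orbit_expr1 kw (xi1 k))); apply/in_cosetP.
exists w^-1 => //; rewrite -frob_orbitV invrK; apply: frob_orbit_trans kw.
by rewrite frob_orbit_sym.
Qed.

End CharacterCosets.

Lemma Zp_nat_eq0 m i : (1 < m)%N -> (i%:R == 0 :> 'Z_m) = (m %| i)%N.
Proof. by move=> m_gt1; rewrite -val_eqE /= val_Zp_nat. Qed.

(** * Powers of q modulo powers of 2 *)

Section ModularOrder.

Variable q : nat.
Hypothesis odd_q : odd q.

Lemma two_exp_gt1 j : (0 < j)%N -> (1 < 2 ^ j)%N.
Proof. by move=> j_gt0; rewrite -{1}(expn0 2) ltn_exp2l. Qed.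

Lemma val_unit_mod j : (0 < j)%N -> val (unit_mod (2 ^ j) q) = q%:R.
Proof.
move=> j_gt0; rewrite /unit_mod val_insubd unitZpE ?two_exp_gt1 //.
by rewrite coprimeXl // coprime2n odd_q.
Qed.

Lemma gen_modP r : (0 < r)%N ->
  reflect (exists t, 2 ^ r %| (q ^ t).+1)%N (-1 \in gen_mod (2 ^ r) q).
Proof.
move=> r_gt0; set m := (2 ^ r)%N; have gt1 : (1 < m)%N by apply: two_exp_gt1.
have E t : (-1 == (q ^ t)%:R :> 'Z_m) = (m %| (q ^ t).+1)%N.
  by rewrite eq_sym -subr_eq0 opprK natr1 Zp_nat_eq0.
apply: (iffP imsetP) => [[_ /cycleP[t ->] /eqP] | [t mt]].
  by rewrite FinRing.val_unitX val_unit_mod // -natrX E; exists t.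
exists (unit_mod m q ^+ t)%g; first exact: mem_cycle.
by apply/eqP; rewrite FinRing.val_unitX val_unit_mod // -natrX E.
Qed.

(** Membership of [-1] passes from [2 ^ j] down to smaller powers and holds modulo [2]. Hence it
    breaks at some [r] with [0 < r < j] exactly when it fails modulo [2 ^ j]. *)
Lemma kappaE j : (0 < j)%N -> kappa q j = if -1 \in gen_mod (2 ^ j) q then 1%N else 2%N.
Proof.
move=> j_gt0; rewrite /kappa; case: ifPn => [/existsP[r /and3P[r_gt0 _]] | ].
  move=> /gen_modP-/(_ isT) no_r; case: gen_modP => // -[t jt]; case: no_r.
  by exists t; apply: dvdn_trans jt; rewrite dvdn_exp2l.
move/existsPn => no_r.
suff mem i : (0 < i)%N -> (i <= j)%N -> -1 \in gen_mod (2 ^ i) q by rewrite mem.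
elim: i => // -[|r] IH _ le_rj.
  (* Modulo [2] the power [q ^ 0 = 1] is already [-1]. *)
  by apply/gen_modP => //; exists 0%N.
have:= no_r (Ordinal le_rj); rewrite /= negb_and.
by rewrite (IH isT (ltnW le_rj)) /= negbK.
Qed.

End ModularOrder.

Section CountOrbits.

Variables (F : finFieldType) (L : fieldExtType F) (j : nat) (xi : L).
Hypotheses (odd_q : odd #|F|) (j_gt1 : (1 < j)%N).
Hypothesis prim_xi : (2 ^ j).-primitive_root xi.

Local Notation q := #|F|.
Local Notation M := (2 ^ j)%N.
Local Notation U := {unit 'Z_M}.

Let M_gt1 : (1 < M)%N.
Proof. by apply/two_exp_gt1/ltnW. Qed.

(** Identifies ['Z_M] with the [M]-th roots of unity; Frobenius becomes multiplication by [q] and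
    inversion becomes negation. *)
Definition zexp (x : 'Z_M) : L := xi ^+ x.

Lemma zexp_nat i : zexp i%:R = xi ^+ i.
Proof. by rewrite /zexp val_Zp_nat // (prim_expr_mod prim_xi). Qed.

Lemma zexp_inj : injective zexp.
Proof.
move=> x y /eqP; rewrite (eq_prim_root_expr prim_xi) => /eqP xy; apply: val_inj.
have lt_M (u : 'Z_M) : (u < M)%N by rewrite -[X in (_ < X)%N]Zp_cast // ltn_ord.
by move: xy; rewrite !modn_small.
Qed.

Lemma zexpD x y : zexp (x + y) = zexp x * zexp y.
Proof. by rewrite -[x]natr_Zp -[y]natr_Zp -natrD !zexp_nat exprD. Qed.

Lemma zexpN x : zexp (- x) = (zexp x)^-1.
Proof.
have x0 : zexp x != 0.
  by rewrite expf_neq0 // (expr1_neq0 (prim_order_gt0 prim_xi) (prim_expr_order prim_xi)).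
by apply: (mulfI x0); rewrite divff // -zexpD subrr (zexp_nat 0).
Qed.

Lemma zexpM_nat x i : zexp (x * i%:R) = zexp x ^+ i.
Proof. by rewrite -[x]natr_Zp -natrM !zexp_nat exprM. Qed.

Definition Zp_neg1 : U := Sub (-1) (unitrN1 _).

Definition orbit_group : {group U} := (<[unit_mod M q]> <*> <[Zp_neg1]>)%G.

Lemma neg1M : (Zp_neg1 * Zp_neg1 = 1)%g.
Proof. by apply: val_inj; rewrite FinRing.val_unitM /= mulrNN mulr1. Qed.

Lemma order_neg1 : #[Zp_neg1]%g = 2%N.
Proof.
apply: nt_prime_order => //; first by apply: val_inj; rewrite FinRing.val_unitX /= sqrrN expr1n.
(* Were [-1 = 1], then [2 ^ j] would divide [2], against [j > 1]. *)
apply/eqP => /(congr1 val) /= /eqP; rewrite eq_sym -subr_eq0 opprK -(natrD _ 1 1).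
rewrite Zp_nat_eq0 // => /(@dvdn_leq M 2 isT); apply/negP; rewrite -ltnNge.
exact: (leq_trans (isT : 2 < 2 ^ 2)%N (leq_pexp2l (isT : (0 < 2)%N) j_gt1)).
Qed.

Lemma frobV_orbit_unit (u v : U) :
  frobV_orbit (zexp (val u)) (zexp (val v)) = (v \in u *: orbit_group)%g.
Proof.
have E (w : U) t : val (w * unit_mod M q ^+ t)%g = val w * (q ^ t)%:R.
  rewrite FinRing.val_unitM FinRing.val_unitX natrX.
  by rewrite val_unit_mod // ltnW.
have fE (w1 w2 : U) :
    frob_orbit (zexp (val w1)) (zexp (val w2)) = (w1^-1 * w2 \in <[unit_mod M q]>)%g.
  apply/frob_orbitP/cycleP => -[t Dt]; exists t.
    apply: (mulgI w1); rewrite mulKVg; apply: val_inj; apply: zexp_inj.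
    by rewrite Dt E zexpM_nat.
  by rewrite -zexpM_nat -E -Dt mulKVg.
rewrite mem_lcoset /= cent_joinEr; last first.
  by apply: sub_abelian_cent2 (units_Zp_abelian M) _ _; apply/subsetP=> ? _; rewrite inE.
rewrite /frobV_orbit -zexpN.
have -> : - val v = val (v * Zp_neg1)%g by rewrite FinRing.val_unitM mulrN1.
rewrite !fE; apply/orP/mulsgP => [[] uv | [x y xq]].
- by exists (u^-1 * v)%g 1%g; rewrite ?mulg1.
- exists (u^-1 * v * Zp_neg1)%g Zp_neg1; rewrite ?cycle_id // -?mulgA //.
  by rewrite neg1M mulg1.
rewrite /= (cycle2g order_neg1) !inE => /orP[]/eqP-> Dx; rewrite ?mulgA Dx.
  by left; rewrite mulg1.
by right; rewrite -mulgA neg1M mulg1.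
Qed.

(** Either [-1] lies in the group generated by [q], or it generates a complement of order 2; [kappa]
    records which. *)
Lemma card_orbit_group : #|orbit_group| = (kappa q j * order_mod M q)%N.
Proof.
have j_gt0 := ltnW j_gt1.
have mem_neg1 : (-1 \in gen_mod M q) = (Zp_neg1 \in <[unit_mod M q]>%g).
  apply/imsetP/idP => [[u uq Du]|]; last by exists Zp_neg1.
  by rewrite (_ : Zp_neg1 = u) //; apply: val_inj.
rewrite /orbit_group /= cent_joinEr; last first.
  by apply: sub_abelian_cent2 (units_Zp_abelian M) _ _; apply/subsetP=> ? _; rewrite inE.
rewrite kappaE // mem_neg1; case: ifP => q1.
  by rewrite mulGSid ?cycle_subG // mul1n.
rewrite TI_cardMg -?orderE ?order_neg1 1?mulnC // setIC prime_TIg -?orderE ?order_neg1 //.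
by rewrite cycle_subG q1.
Qed.

Lemma odd_unit_Zp (u : U) : odd (val u : 'Z_M).
Proof.
have := valP u; rewrite -{1}[val u]natr_Zp unitZpE // coprime_sym.
by rewrite coprime_pexpr ?coprimen2 // ltnW.
Qed.

Lemma exprz_zexp (k : int) : odd `|k|%N -> exists u : U, xi ^ k = zexp (val u).
Proof.
move=> odd_k; have /(prim_rootP prim_xi)[i Di] : (xi ^ k) ^+ M = 1.
  by rewrite (exprz_modz prim_xi) exprAC (prim_expr_order prim_xi) expr1n.
have co : i%:R \is a @GRing.unit 'Z_M.
  rewrite unitZpE // coprime_sym -(prim_root_exp_coprime _ prim_xi) -Di.
  by apply: (prim_root_exprz prim_xi); rewrite coprimeXr ?coprimen2.
by exists (Sub (i%:R : 'Z_M) co : U); rewrite /= zexp_nat.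
Qed.

(** Double counting of the pairs of a unit [v] and a representative [l] of its orbit: each [v] has
    one [l], and each [l] has a coset of [orbit_group]. *)
Lemma count_orbit_reps (s : seq int) :
    uniq s -> (forall k, k \in s -> odd `|k|%N) ->
    (forall k : int, odd `|k|%N ->
       exists! l : int, l \in s /\ frobV_orbit (xi ^ k) (xi ^ l)) ->
  (size s * (kappa q j * order_mod M q))%N = totient M.
Proof.
move=> us odd_s ex_s; rewrite -card_orbit_group -card_units_Zp ?expn_gt0 //.
rewrite cardsT -[in RHS]sum1_card.
transitivity (\sum_(v : U) \sum_(l <- s) frobV_orbit (xi ^ l) (zexp (val v)))%N; last first.
  apply: eq_big => // v _; have [l [[sl vl] l_uniq]] := ex_s (val v : nat) (odd_unit_Zp v).
  rewrite -exprnP in vl l_uniq.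
  rewrite (bigD1_seq l) //= frobV_orbit_sym vl big_seq_cond big1 //.
  move=> i /andP[si ne_il]; apply/eqP; rewrite eqb0; apply: contra ne_il => iv.
  by apply/eqP/esym/l_uniq; rewrite frobV_orbit_sym.
rewrite exchange_big /= -sum1_size big_distrl /= big_seq [in RHS]big_seq.
apply: eq_bigr => l sl; rewrite mul1n.
have [u ->] := exprz_zexp (odd_s _ sl).
rewrite -(card_lcoset _ u) -sum1_card big_mkcond /=.
by apply: eq_bigr => v _; rewrite frobV_orbit_unit; case: (v \in _).
Qed.

End CountOrbits.

(** * The complete family *)

Section CompleteFamily.

Variables (F : finFieldType) (L : fieldExtType F) (gT : finGroupType).
Variables (G : {group gT}) (a b : gT) (z : L).
Hypotheses (Ga : a \in G) (Gb : b \in G) (prim_z : #[a]%g.-primitive_root z).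
Hypotheses (ob : #[b]%g = 2%N) (ab : (a ^ b = a^-1)%g) (Xb : b \notin <[a]>%g).
Hypotheses (defG : (<[a]> * <[b]> = G)%g) (two_neq0 : 2%:R != 0 :> F).

Local Notation R_G := (group_ring F G).
Local Notation half := (half_idem G b).

(** On [u f], both [a] and [b] act as the scalars [s] and [c] from either side, so every element of
    the group algebra acts by the same scalar on the left and on the right. *)
Lemma central_half_idem (u : 'M[F]_#|G|) (s c : F) w :
    orbit_idem a (w : L) u -> u *m regular_repr F G a = s *: u -> c * c = 1 ->
  (u *m half c \in 'Z(R_G))%MS.
Proof.
move=> uw ua cc; have [ucR _] := orbit_half_idempotent Ga Gb prim_z ob ab two_neq0 uw cc.
have uc := orbit_idem_comm_half Ga Gb prim_z ab c uw.
have up p : u *m gpoly G a p = p.[s] *: u.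
  elim/poly_ind: p => [|p d IH]; first by rewrite linear0 mulmx0 horner0 scale0r.
  rewrite linearD mulmxDr /= (mulrC p) gpolyM // (gpolyXn F G a 1) expg1 mulmxA ua.
  rewrite -scalemxAl IH scalerA -[d%:P]mulr1 mul_polyC linearZ /= gpoly1.
  rewrite -scalemxAr mulmx1 -scalerDl !hornerE //.
have pu p : gpoly G a p *m u = p.[s] *: u.
  by rewrite -up; case: uw => r -> _; rewrite -!gpolyM // mulrC.
have hb : half c *m regular_repr F G b = c *: half c.
  rewrite -emb_half_idem // /half_idem -scalemxAl -scalemxAr mulmxDl mulmxDr.
  by rewrite mulmx1 mul1mx -scalemxAl -scalemxAr.
move: ucR; set e := u *m half c => eR.
have pe p : gpoly G a p *m e = p.[s] *: e by rewrite mulmxA pu -scalemxAl.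
have ep p : e *m gpoly G a p = p.[s] *: e.
  by rewrite /e uc -mulmxA up -scalemxAr.
have be : regular_repr F G b *m e = c *: e.
  by rewrite /e uc mulmxA emb_half_idem // -scalemxAl.
have eb : e *m regular_repr F G b = c *: e by rewrite -mulmxA hb -scalemxAr.
apply/center_mxP; split=> // _ /(group_ring_gpoly Ga Gb ob defG)[p1 [p2 ->]].
rewrite mulmxDl mulmxDr pe ep -mulmxA be mulmxA ep -scalemxAr pe -scalemxAl eb.
by rewrite !scalerA mulrC.
Qed.

Section Labels.

Variables (T : eqType) (lab : seq T) (W : T -> L) (U : T -> 'M[F]_#|G|).
Hypotheses (uniq_lab : uniq lab) (W1 : {in lab, forall t, W t ^+ #[a]%g = 1}).
Hypothesis UW : {in lab, forall t, orbit_idem a (W t) (U t)}.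
Hypothesis W_neq : {in lab &, forall s t, s != t -> ~~ frobV_orbit (W s) (W t)}.
Hypothesis W_cover : forall x : L, x ^+ #[a]%g = 1 ->
  exists2 t, t \in lab & frobV_orbit (W t) x.

Definition half_family := [seq U t *m half c | t <- lab, c <- [:: 1; -1]].

Let sgn2 (c : F) : c \in [:: 1; -1] -> c * c = 1.
Proof. by rewrite !inE => /orP[]/eqP->; rewrite ?mulrNN mulr1. Qed.

Let half_familyM s t (c d : F) : s \in lab -> t \in lab ->
    c \in [:: 1; -1] -> d \in [:: 1; -1] -> (s, c) != (t, d) ->
  U s *m half c *m (U t *m half d) = 0.
Proof.
move=> ls lt c2 d2 ne; rewrite mulmxA -(mulmxA (U s)).
rewrite -(orbit_idem_comm_half Ga Gb prim_z ab c (UW lt)) mulmxA.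
have [est | /(W_neq ls lt) st] := eqVneq s t; last first.
  by rewrite (orbit_idem_orth Ga prim_z (UW ls) (UW lt) st) !mul0mx.
have -> : c = - d.
  move: ne c2 d2; rewrite est xpair_eqE eqxx /= !inE.
  by move=> cd /orP[]/eqP Dc /orP[]/eqP Dd; move: cd; rewrite Dc Dd ?opprK ?eqxx.
by rewrite -mulmxA half_idem_orth ?mulmx0 // sgn2.
Qed.

Let half_family_neq0 t c : t \in lab -> U t *m half c != 0.
Proof.
by move=> lt; have := orbit_idem_half_neq0 Ga Gb prim_z Xb two_neq0 c (W1 lt) (UW lt).
Qed.

(** Two equal entries at different indices would be orthogonal to each other, so the idempotent
    would be its own square [0]. *)
Lemma uniq_half_family : uniq half_family.
Proof.
apply: allpairs_uniq => //.
  by rewrite /=  andbT inE -subr_eq0 opprK -mulr2n.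
move=> _ _ /allpairsP[[s c] [ls c2 ->]] /allpairsP[[t d] [lt d2 ->]] /= E.
apply/eqP; apply: contraTT isT => ne.
have [_ idem] := orbit_half_idempotent Ga Gb prim_z ob ab two_neq0 (UW ls) (sgn2 c2).
by case/eqP: (half_family_neq0 c ls); rewrite -idem {2}E half_familyM.
Qed.

(** Each root of unity lies in exactly one labelled orbit, so the sum takes the value 1
    everywhere. *)
Lemma sum_orbit_idem : \sum_(t <- lab) U t = 1%:M.
Proof.
have partial s : {subset s <= lab} -> exists2 p, \sum_(t <- s) U t = gpoly G a p &
    forall x : L, x ^+ #[a]%g = 1 ->
      horner_alg x p = \sum_(t <- s) (frobV_orbit (W t) x)%:R.
  elim: s => [|t s IH] sub.
    by exists 0; rewrite ?linear0 ?big_nil // => x _; rewrite rmorph0 big_nil.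
  have [|p Dp Hp] := IH; first by move=> r rs; apply: sub; rewrite inE rs orbT.
  have [r Dr Hr] := UW (sub t (mem_head t s)).
  exists (r + p); first by rewrite big_cons Dr Dp linearD.
  by move=> x x1; rewrite big_cons rmorphD /= Hr // Hp.
have [//|p -> Hp] := partial lab.
rewrite -(gpoly1 F G a); apply: (gpoly_eq Ga prim_z) => x x1.
rewrite Hp // rmorph1.
have [t lt tx] := W_cover x1; rewrite (bigD1_seq t) //= tx big_seq_cond big1 ?addr0 //.
move=> s /andP[ls st]; have := W_neq ls lt st; case sx: (frobV_orbit (W s) x) => //.
by rewrite (frobV_orbit_trans sx) // frobV_orbit_sym.
Qed.

Lemma half_family_complete :
  complete_primitive_orthogonal R_G half_family /\
  decomposes_into_minimal_left_ideals R_G half_family.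
Proof.
apply: complete_orthogonal_decomposition.
- exact: envelop_mx1.
- by move=> x y; apply: envelop_mxM.
- move=> _ /allpairsP[[t c] [/= lt c2 ->]].
  by have := orbit_half_idempotent Ga Gb prim_z ob ab two_neq0 (UW lt) (sgn2 c2).
- move=> _ /allpairsP[[t c] [/= lt c2 ->]].
  by have := orbit_half_minimal Ga Gb prim_z ob ab Xb defG two_neq0
    (W1 lt) (UW lt) (sgn2 c2).
- exact: uniq_half_family.
- move=> _ _ /allpairsP[[s c] [ls c2 ->]] /allpairsP[[t d] [lt d2 ->]] /= ne.
  by apply: half_familyM => //; apply: contraNneq ne => -[-> ->].
rewrite /half_family big_allpairs_dep /= -sum_orbit_idem; apply: eq_bigr => t _.
by rewrite !big_cons big_nil addr0 -mulmxDr half_idemD ?mulmx1.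
Qed.

End Labels.

End CompleteFamily.

(** Frobenius and inversion preserve the equation [u ^+ m = 1], and the relation is symmetric, so
    each order divides the other. *)
Lemma prim_root_frobV_orbit (F : finFieldType) (L : fieldExtType F) (w x : L) m1 m2 :
    m1.-primitive_root w -> m2.-primitive_root x -> frobV_orbit w x -> m1 = m2.
Proof.
have exp1 (u v : L) m : frobV_orbit u v -> u ^+ m = 1 -> v ^+ m = 1.
  case/orP=> /frob_orbit_expr1/[apply] //.
  by rewrite exprVn => /(congr1 GRing.inv); rewrite invrK invr1.
move=> prim_w prim_x wx; apply/eqP; rewrite eqn_dvd.
rewrite (prim_order_dvd prim_w) (prim_order_dvd prim_x); apply/andP; split; apply/eqP.
  by apply: exp1 (prim_expr_order prim_x); rewrite frobV_orbit_sym.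
exact: exp1 wx (prim_expr_order prim_w).
Qed.

(** * Labelling of the orbits and assembly of the list *)

Section Main.

Variables (F : finFieldType) (L : splittingFieldType F) (gT : finGroupType).
Variables (G : {group gT}) (a b : gT) (n : nat).
Variables (xi : nat -> L) (reps : nat -> seq int).
Hypothesis n_gt1 : (1 < n)%N.
Hypothesis hG : dihedral_presentation G (2 ^ n) a b.
Hypothesis hxi : forall j, (2 <= j <= n)%N -> (2 ^ j).-primitive_root (xi j).
Hypothesis hreps : forall j, (2 <= j <= n)%N -> orbit_representatives G a j (xi j) (reps j).

Local Notation half := (half_idem G b).

Let oa : #[a]%g = (2 ^ n)%N.
Proof. by have [] := dihedral_structure (ltnW n_gt1) hG. Qed.
Let ob : #[b]%g = 2%N.
Proof. by have [] := dihedral_structure (ltnW n_gt1) hG. Qed.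
Let Xb : b \notin <[a]>%g.
Proof. by have [] := dihedral_structure (ltnW n_gt1) hG. Qed.
Let defG : (<[a]> * <[b]> = G)%g.
Proof. by have [] := dihedral_structure (ltnW n_gt1) hG. Qed.
Let ab : (a ^ b = a^-1)%g.
Proof. by case: hG => _ []. Qed.
Let Ga : a \in G.
Proof. by rewrite -defG (subsetP (mulG_subl _ _)) ?cycle_id. Qed.
Let Gb : b \in G.
Proof. by rewrite -defG (subsetP (mulG_subr _ _)) ?cycle_id. Qed.
Let prim_z : #[a]%g.-primitive_root (xi n).
Proof. by rewrite oa hxi // n_gt1 leqnn. Qed.
Let two_neq0 : 2%:R != 0 :> F.
Proof.
(* The even order of the primitive root [xi n] forces 2 to be nonzero. *)
rewrite -(fmorph_eq0 (in_alg L)) rmorph_nat (prim_root_dvd_eq0 prim_z) // oa.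
by rewrite dvdn_exp // ltnW.
Qed.

Lemma orbit_reps_frobV j : (2 <= j <= n)%N ->
  forall k : int, odd `|k|%N ->
    exists! l : int, l \in reps j /\ frobV_orbit (xi j ^ k) (xi j ^ l).
Proof.
move=> jn k odd_k; have [_ _ /(_ k odd_k)[l [[rl kl] l_uniq]]] := hreps jn.
have /andP[j_gt1 le_jn] := jn.
have P := coset_conjugateP oa ab Ga Gb ob defG le_jn (hxi jn).
by exists l; split=> [|i [ri /P ki]]; [split=> //; apply/P | apply: l_uniq].
Qed.

Definition labels (js : seq nat) : seq (nat * int) := [seq (j, k) | j <- js, k <- reps j].

(* The labels (0, 1) and (1, 1) stand for the orbits of 1 and -1, so that the
   root attached to (j, k) always has order 2 ^ j. *)
Definition all_labels : seq (nat * int) :=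
  [:: (0%N, 1); (1%N, 1)] ++ labels (index_iota 2 n.+1).

Definition label_root (t : nat * int) : L :=
  if t.1 == 0%N then 1 else if t.1 == 1%N then - 1 else xi t.1 ^ t.2.

Definition label_idem (t : nat * int) : 'M[F]_#|G| :=
  if t.1 == 0%N then cycle_idem F G a else if t.1 == 1%N then alt_idem F G a
  else ejk G a t.1 (xi t.1) t.2.

Lemma all_labelsP t : reflect
  [\/ t = (0%N, 1), t = (1%N, 1) | (2 <= t.1 <= n)%N /\ t.2 \in reps t.1]
  (t \in all_labels).
Proof.
rewrite mem_cat !inE -orbA; apply: (iffP or3P) => -[/eqP->|/eqP->|H];
  [by constructor 1 | by constructor 2 | constructor 3 |
   by constructor 1 | by constructor 2 | constructor 3].
  by case/allpairsPdep: H => j [k [jn kj ->]]; rewrite mem_index_iota in jn.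
case: H => tn t2; apply/allpairsPdep; exists t.1, t.2.
by rewrite mem_index_iota -surjective_pairing.
Qed.

Lemma uniq_all_labels : uniq all_labels.
Proof.
rewrite cat_uniq; apply/and3P; split=> //.
  apply/hasPn => t /allpairsPdep[j [k [jn _ ->]]].
  move: jn; rewrite mem_index_iota !inE !xpair_eqE => /andP[].
  by case: j => [|[]].
apply: allpairs_uniq_dep => [|j|]; first exact: iota_uniq.
  by rewrite mem_index_iota => /hreps[].
by move=> [j1 k1] [j2 k2] _ _ /= [-> ->].
Qed.

Lemma label_root_prim t : t \in all_labels ->
  (t.1 <= n)%N /\ (2 ^ t.1).-primitive_root (label_root t).
Proof.
case/all_labelsP=> [->|->|[jn tj]]; rewrite /label_root /=.
- split=> //; rewrite expn0; apply/andP; split=> //.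
  by apply/forallP=> i; rewrite ord1 unity_rootE expr1 eqxx.
- split; first exact: ltnW.
  have [|m prim_m m2] := @prim_order_exists L 2 (- 1) isT; first by rewrite sqrrN expr1n.
  case: m prim_m m2 => [|[|[|m]]] // prim_m _.
  have := prim_expr_order prim_m; rewrite expr1 => /eqP.
  by rewrite eq_sym -subr_eq0 opprK -mulr2n (negPf (two_neq0L L two_neq0)).
have /andP[j_gt1 le_jn] := jn; rewrite gtn_eqF ?(ltnW j_gt1) // gtn_eqF //.
by split=> //; apply: prim_root_odd_exprz (hxi jn) _; have [_ odd_s _] := hreps jn; apply: odd_s.
Qed.

Lemma label_root_expr1 : {in all_labels, forall t, label_root t ^+ #[a]%g = 1}.
Proof.
move=> t /label_root_prim[le_tn prim_t]; apply/eqP.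
by rewrite -(prim_order_dvd prim_t) oa dvdn_exp2l.
Qed.

Lemma label_idem_orbit :
  {in all_labels, forall t, orbit_idem a (label_root t) (label_idem t)}.
Proof.
move=> t /all_labelsP[->|->|[jn tj]]; rewrite /label_root /label_idem /=.
- by have := cycle_idem_orbit G prim_z.
- by have := alt_idem_orbit G prim_z two_neq0.
have /andP[j_gt1 le_jn] := jn; rewrite gtn_eqF ?(ltnW j_gt1) // gtn_eqF //.
apply: (ejk_orbit Ga Gb prim_z ob ab Xb defG two_neq0 (hxi jn)).
by have [_ odd_s _] := hreps jn; apply: odd_s.
Qed.

(** The order of the root fixes the level; within a level [j >= 2], uniqueness of the orbit
    representative fixes [k], and levels 0 and 1 carry one label each. *)
Lemma label_root_neq :
  {in all_labels &, forall s t, s != t -> ~~ frobV_orbit (label_root s) (label_root t)}.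
Proof.
move=> s t ls lt; apply: contra => st.
have [_ prim_s] := label_root_prim ls; have [_ prim_t] := label_root_prim lt.
have /eqP := prim_root_frobV_orbit prim_s prim_t st.
rewrite eqn_exp2l // => /eqP st1.
have small r : r \in all_labels -> (r.1 < 2)%N -> r = (r.1, 1).
  by case/all_labelsP=> [->|->|[/andP[r2 _] _]] //; rewrite ltnNge r2.
have big r : r \in all_labels -> (1 < r.1)%N -> (1 < r.1 <= n)%N /\ r.2 \in reps r.1.
  by case/all_labelsP=> [->|->|].
have [s2 | s2] := ltnP s.1 2.
  by rewrite (small s) // (small t) // -st1.
have [sn sj] := big s ls s2; have [tn tj] := big t lt (leq_trans s2 (eq_leq st1)).
move: st; rewrite /label_root -st1 gtn_eqF ?(ltnW s2) // gtn_eqF // => st.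
have [_ odd_s _] := hreps sn.
have [l [_ l_uniq]] := orbit_reps_frobV sn (odd_s _ sj).
have l_t : l = t.2 by apply: l_uniq; rewrite {1}st1.
have l_s : l = s.2 by apply: l_uniq; rewrite frobV_orbit_refl.
by rewrite [s]surjective_pairing [t]surjective_pairing st1 -l_s -l_t.
Qed.

(** The order of [x] is some [2 ^ j] with [j <= n]: for [j < 2] this means [x] is [1] or [- 1], and
    otherwise [x] is an odd power of [xi j]. *)
Lemma label_root_cover (x : L) : x ^+ #[a]%g = 1 ->
  exists2 t, t \in all_labels & frobV_orbit (label_root t) x.
Proof.
move=> x1; have [m prim_x] := prim_order_exists (order_gt0 a) x1.
rewrite oa => /(dvdn_pfactor _ _ (isT : prime 2))[j le_jn Dm]; rewrite {m}Dm in prim_x.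
case: j le_jn prim_x => [|[|j]] le_jn prim_x.
- exists (0%N, 1); first by apply/all_labelsP; constructor 1.
  by rewrite /label_root /= frobV_orbit1 -(prim_expr_order prim_x).
- exists (1%N, 1); first by apply/all_labelsP; constructor 2.
  rewrite /label_root /= (frobV_orbitN1 two_neq0).
  have /eqP := prim_expr_order prim_x; rewrite expn1 sqrf_eq1 => /orP[/eqP x_1|//].
  have := prim_order_dvd prim_x 1; rewrite x_1 expr1 eqxx.
  by rewrite dvdn1.
have jn : (2 <= j.+2 <= n)%N by [].
have /(prim_rootP (hxi jn))[i Dx] := prim_expr_order prim_x.
have odd_i : odd `|i : int|%N.
  have : coprime i (2 ^ j.+2) by rewrite -(prim_root_exp_coprime _ (hxi jn)) -Dx.
  by rewrite coprime_pexpr // coprimen2.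
have [l [[rl il] _]] := orbit_reps_frobV jn odd_i.
exists (j.+2, l); first by apply/all_labelsP; constructor 3.
by rewrite /label_root /= frobV_orbit_sym Dx.
Qed.

Lemma level_idempotentsE j : (2 <= j)%N ->
  level_idempotents G a b j (xi j) (reps j) =
    half_family b [seq (j, k) | k <- reps j] label_idem.
Proof.
move=> j_gt1; rewrite /half_family /level_idempotents -map_comp; congr flatten.
apply: eq_map => k; rewrite /= /label_idem /= gtn_eqF ?(ltnW j_gt1) // gtn_eqF //.
by rewrite one_sub_hat_involution // hat_involution.
Qed.

(** An equality of sequences: the order of the labels, each with sign [1] before [- 1], is the order
    of the list. *)
Lemma all_idempotentsE :
  all_idempotents G a b n xi reps = half_family b all_labels label_idem.
Proof.
have E js : all (leq 2) js ->
    flatten [seq level_idempotents G a b j (xi j) (reps j) | j <- js] =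
    half_family b (labels js) label_idem.
  elim: js => //= j js IH /andP[j_gt1 /IH {}IH].
  have -> : labels (j :: js) = [seq (j, k) | k <- reps j] ++ labels js by [].
  by rewrite IH level_idempotentsE // /half_family allpairs_cat.
rewrite /all_idempotents E; last by apply/allP=> j; rewrite mem_index_iota => /andP[].
rewrite (e1E F Ga Gb ob Xb defG) (e2E Ga Gb ob Xb defG two_neq0) (e3E F Ga Gb ob ab Xb defG).
by rewrite (e4E Ga Gb prim_z ob ab Xb defG two_neq0).
Qed.

Lemma size_level_idempotents j : (2 <= j <= n)%N ->
  (size (level_idempotents G a b j (xi j) (reps j))
     * (kappa #|F| j * order_mod (2 ^ j) #|F|))%N = (2 * totient (2 ^ j))%N.
Proof.
move=> jn; have /andP[j_gt1 _] := jn.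
have -> : size (level_idempotents G a b j (xi j) (reps j)) = (2 * size (reps j))%N.
  by rewrite level_idempotentsE // size_allpairs size_map mulnC.
have [us odd_s _] := hreps jn.
rewrite -mulnA (count_orbit_reps (odd_card_field two_neq0) j_gt1 (hxi jn) us odd_s) //.
exact: orbit_reps_frobV.
Qed.

(** Multiplication by [a] is the scalar [1] on [cycle_idem] and [- 1] on [alt_idem], so the scalar
    criterion for centrality applies. *)
Lemma central_idempotents e :
  e \in [:: e1 F G; e2 F G a; e3 F G a b; e4 F G a b] -> (e \in 'Z(group_ring F G))%MS.
Proof.
have cyc := cycle_idem_orbit G prim_z; have alt := alt_idem_orbit G prim_z two_neq0.
have uc : cycle_idem F G a *m regular_repr F G a = 1 *: cycle_idem F G a.
  by rewrite scale1r (emb_cycle_idem Ga prim_z).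
have ua : alt_idem F G a *m regular_repr F G a = - 1 *: alt_idem F G a.
  by rewrite scaleN1r (emb_alt_idem Ga prim_z two_neq0).
have C1 := central_half_idem Ga Gb prim_z ob ab defG two_neq0 cyc uc.
have C2 := central_half_idem Ga Gb prim_z ob ab defG two_neq0 alt ua.
rewrite (e1E F Ga Gb ob Xb defG) (e2E Ga Gb ob Xb defG two_neq0) (e3E F Ga Gb ob ab Xb defG).
rewrite (e4E Ga Gb prim_z ob ab Xb defG two_neq0) !inE.
by case/or4P=> /eqP->; [apply: C1 | apply: C1 | apply: C2 | apply: C2]; rewrite ?mulrNN mulr1.
Qed.

Lemma all_idempotents_decomposition :
  [/\ complete_primitive_orthogonal (group_ring F G) (all_idempotents G a b n xi reps),
      decomposes_into_minimal_left_ideals (group_ring F G)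
        (all_idempotents G a b n xi reps)
    & uniq (all_idempotents G a b n xi reps)].
Proof.
rewrite all_idempotentsE.
have [] := half_family_complete Ga Gb prim_z ob ab Xb defG two_neq0 uniq_all_labels
  label_root_expr1 label_idem_orbit label_root_neq label_root_cover.
by split=> //; apply: (uniq_half_family Ga Gb prim_z ob ab Xb two_neq0
  uniq_all_labels label_root_expr1 label_idem_orbit label_root_neq).
Qed.

End Main.

Theorem corollary3p4
    (n p m q : nat) (hn : (3 <= n)%N)
    (hp : prime p) (hodd : odd p) (hm : (0 < m)%N) (hq : q = (p ^ m)%N)
    (F : finFieldType) (hF : #|F| = q)
    (gT : finGroupType) (G : {group gT}) (a b : gT)
    (hG : dihedral_presentation G (2 ^ n) a b)
    (L : splittingFieldType F) (xi : nat -> L)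
    (hxi : forall j : nat, (2 <= j <= n)%N -> (2 ^ j).-primitive_root (xi j))
    (reps : nat -> seq int)
    (hreps : forall j : nat, (2 <= j <= n)%N ->
       orbit_representatives G a j (xi j) (reps j)) :
  [/\ complete_primitive_orthogonal (group_ring F G)
        (all_idempotents G a b n xi reps),
      decomposes_into_minimal_left_ideals (group_ring F G)
        (all_idempotents G a b n xi reps),
      (forall e, e \in [:: e1 F G; e2 F G a; e3 F G a b; e4 F G a b] ->
         (e \in 'Z(group_ring F G))%MS),
      uniq (all_idempotents G a b n xi reps)
    & forall j : nat, (2 <= j <= n)%N ->
        (size (level_idempotents G a b j (xi j) (reps j))
           * (kappa q j * order_mod (2 ^ j) q))%N
        = (2 * totient (2 ^ j))%N].

Proof.
have n_gt1 : (1 < n)%N by apply: ltnW.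
rewrite -hF; have [complete_all decomp_all uniq_all] :=
  all_idempotents_decomposition n_gt1 hG hxi hreps.
split=> //; first exact: central_idempotents n_gt1 hG hxi.
by move=> j jn; have := size_level_idempotents n_gt1 hG hxi hreps jn.
Qed.
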